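(* Let $p$ be a prime, let $G$ be a finite group and let $P$ be a Sylow $p$-subgroup of $G$. Assume that $O_{p'}(G)=1$ and $|P|\geq p^2$. If every $2$-maximal subgroup of $P$ satisfies the partial $\Pi$-property in $G$, then one of the following statements holds: (1) $G$ is $p$-supersoluble; (2) $|P|=p^2$ and $P=O_p(G)$ is a minimal normal subgroup of $G$; (3) $|P|=p^2$ and $G$ is not $p$-soluble; (4) $p=2$ and $P$ is isomorphic to the quaternion group $Q_8$ of order $8$; (5) $|P|\geq p^3$ and $G=P\rtimes H$, where $H$ is a Hall $p'$-subgroup of $G$ and $H$ is cyclic; furthermore, $\Phi(P)$ is the intersection of all $2$-maximal subgroups of $P$, and $P/\Phi(P)=V_1\times\cdots\times V_s$, where $V_1,\dots,V_s$ are pairwise $H$-isomorphic irreducible $\mathbb{F}_p[H]$-modules, each of dimension $2$ over $\mathbb{F}_p$.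
   Context: All groups are finite. For a group $K$, $\pi(K)$ is the set of primes dividing $|K|$; for a set $\pi$ of primes, a $\pi$-number is a positive integer all of whose prime divisors lie in $\pi$ (so the only $\emptyset$-number is $1$). A subgroup $H$ of a group $G$ satisfies the partial $\Pi$-property in $G$ if there exists a chief series $1=G_0<G_1<\cdots<G_n=G$ of $G$ such that, for every $1\leq i\leq n$, the index $\left|G/G_{i-1}:N_{G/G_{i-1}}\big((HG_{i-1}/G_{i-1})\cap(G_i/G_{i-1})\big)\right|$ is a $\pi\big((HG_{i-1}/G_{i-1})\cap(G_i/G_{i-1})\big)$-number. A $2$-maximal (second maximal) subgroup of the $p$-group $P$ is a maximal subgroup of a maximal subgroup of $P$, i.e. a subgroup of $P$ of index $p^2$. A group $G$ is $p$-soluble if every chief factor of $G$ is either a $p$-group or a $p'$-group, and $p$-supersoluble if every chief factor of $G$ of order divisible by $p$ is cyclic (i.e. of order $p$). $O_{p'}(G)$ and $O_p(G)$ are the largest normal $p'$-subgroup and the largest normal $p$-subgroup of $G$; $\Phi(P)$ is the Frattini subgroup of $P$. $\mathbb{F}_p$ is the field with $p$ elements; in (5), $P/\Phi(P)$ is regarded as an $\mathbb{F}_p[H]$-module via the conjugation action of $H$, and $H$-isomorphic means isomorphic as $\mathbb{F}_p[H]$-modules. *)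

(* Defs.v *)
From mathcomp Require Import all_boot all_order all_fingroup all_algebra.
From mathcomp Require Import all_solvable all_field all_character.

Set Implicit Arguments.
Unset Strict Implicit.
Unset Printing Implicit Defensive.

Local Open Scope group_scope.

Section PartialPi.

Variable gT : finGroupType.
Implicit Types G H K N P : {group gT}.

(* For N <| G, the MathComp quotient H / N is the image of H in G / N, that   *)
(* is HN/N.  The list s holds G_1, ..., G_n, so that G_(i-1) is the i-th      *)
(* entry (counting from 0) of 1 :: s when G_i is the i-th entry of s.         *)
Definition partial_Pi_property G H : Prop :=
  exists s : seq {group gT},
    [/\ (G.-chief).-series 1%G s,
        last 1%G s = G
      & forall i : nat, i < size s ->
          let N := nth 1%G (1%G :: s) i in
          let K := nth 1%G s i in
          let X := (H / N) :&: (K / N) in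
          \pi(X).-nat #|G / N : 'N_(G / N)(X)|].

Definition two_maximal K P : bool :=
  [exists M : {group gT}, maximal K M && maximal M P].

Definition p_soluble (p : nat) G : Prop :=
  forall N K : {group gT}, chief_factor G N K ->
    p.-group (K / N) \/ p^'.-group (K / N).

Definition p_supersoluble (p : nat) G : Prop :=
  forall N K : {group gT}, chief_factor G N K ->
    p %| #|K / N| -> cyclic (K / N).

End PartialPi.

Section FrattiniModule.

Variables (gT : finGroupType) (p : nat) (P H : {group gT}).
Hypotheses (pP : p.-group P) (ntP : P :!=: 1) (nPH : H \subset 'N(P)).

Lemma Frattini_abelem : p.-abelem (P / 'Phi(P)).
Proof. exact: Phi_quotient_abelem pP. Qed.

Lemma Frattini_quo_neq1 : P / 'Phi(P) != 1.
Proof.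
by rewrite -subG1 quotient_sub1 ?gFnorm // proper_subn ?Phi_proper.
Qed.

Lemma Frattini_norm : H \subset 'N('Phi(P)).
Proof. exact: char_norm_trans (Phi_char P) nPH. Qed.

Lemma Frattini_quo_norm : H / 'Phi(P) \subset 'N(P / 'Phi(P)).
Proof. exact: quotient_norms. Qed.

(* P / 'Phi(P) as an F_p[H]-module: h in H acts on the row vectors over 'F_p  *)
(* representing P / 'Phi(P) as conjugation by the coset of h.                 *)
Definition Frattini_repr : mx_representation 'F_p H ('dim (P / 'Phi(P))) :=
  morphim_repr (f := coset_morphism 'Phi(P))
    (abelem_repr Frattini_abelem Frattini_quo_neq1 Frattini_quo_norm)
    Frattini_norm.

End FrattiniModule.

(* Main.v *)
Require Import Defs.
From mathcomp Require Import all_boot all_order all_fingroup all_algebra.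
From mathcomp Require Import all_solvable all_field all_character.

(** The partial Pi-property is used through single steps of the chief series it
    provides. If [H] lies in a Sylow p-subgroup [P] and its section
    [X = HN / N :&: K / N] at a factor [K / N] of the series is nontrivial, the
    index of the normaliser of [X] is a power of [p]. Then [K / N] is a p-group,
    and [X] is all of [K / N] as soon as [P] normalises [X]
    ([PiP_pgroup_step]). The step at which the series leaves a given subgroup
    turns this into restrictions on the chief factors of [G] ([PiP_first_step],
    [PiP_pgroup_factor], [PiP_cover_unique_factor], [PiP_avoided_factor]).

    Suppose first that [G] is not p-soluble and [#|P| >= p ^ 3]. In a smallest
    normal subgroup [T] that has a chief factor [T / S] which is neither a
    p-group nor a p'-group, every 2-maximal subgroup of [P] meets [T] inside [S];
    hence [P] lies in [T] and has cyclic maximal subgroups outside [S], and transfer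
    into an abelian Sylow subgroup of the perfect group [T] leaves only
    the case where [P] has a unique 2-maximal subgroup ([not_p_soluble_Q8]).
    A noncyclic [P] of order at least [p ^ 3] with a unique 2-maximal subgroup
    is the quaternion group of order 8 ([unique_two_maximal_Q8]).

    Suppose now that [G] is p-soluble. If [P] were not normal, some quotient of
    [G] of p-length greater than one would be a split extension of its unique
    minimal normal subgroup [F], and a 2-maximal subgroup of [P] containing a part
    of [F], but not all of it, would not have the partial Pi-property
    ([p_soluble_normal_Sylow]). So [G] is the semidirect product of [P] with a
    p'-group [A], and [A] acts faithfully on the semisimple module
    [V = P / 'Phi(P)]. A 2-maximal subgroup containing ['Phi(P)] is a subspace of
    codimension 2 in [V], and the chief factors it avoids give an [A]-module of
    dimension at most 2 that spans [V] together with it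
    ([Frattini_two_dim_complements]). This is a condition of pure linear algebra.
    For two simple summands [U1] and [U2] of [V] take the subspace spanned by a
    hyperplane of [U1], a hyperplane of [U2] and all other summands: a module [D] of
    dimension 2 avoiding it projects onto both [U1] and [U2]. So either all simple
    summands have dimension 1, or all are isomorphic of dimension 2
    ([two_dim_complements_structure]); and when there are at least two, choosing
    suitable lines as hyperplanes shows that [A] acts on each of them by commuting
    matrices ([two_dim_complements_commute]).

    If all summands are lines, [A] is abelian of exponent dividing [p.-1], its
    irreducible modules over the prime field have dimension 1, and [G] is
    p-supersoluble. Otherwise [V] contains no line and all 2-maximal subgroups
    contain ['Phi(P)] ([Phi_sub_two_maximal]). With a single summand, ['Phi(P)] is
    the only 2-maximal subgroup of [P]: then [P] is minimal normal of order
    [p ^ 2], or else quaternion of order 8. With several summands [A] is abelian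
    and faithful on each of them, hence cyclic. *)

Set Implicit Arguments.
Unset Strict Implicit.
Unset Printing Implicit Defensive.

Local Open Scope group_scope.

(** * Steps of a chief series with the partial Pi-property *)

(** A property that fails for the trivial subgroup and holds for [G] is acquired
    at some factor of the chief series. *)
Lemma PiP_first_step (gT : finGroupType) (G H : {group gT}) (C : pred {group gT}) :
    partial_Pi_property G H -> ~~ C 1%G -> C G ->
  exists N K : {group gT}, let X := (H / N) :&: (K / N) in
    [/\ chief_factor G N K, ~~ C N, C K
      & \pi(X).-nat #|G / N : 'N_(G / N)(X)|].
Proof.
case=> s [chs lastG stepP] nC1 CG.
have hasC: has C s.
  apply/hasP; exists G => //; rewrite -lastG.
  case: s lastG {chs stepP} => [/= E|a s _]; last by rewrite /= mem_last.
  by rewrite E CG in nC1.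
have lt_s: find C s < size s by rewrite -has_find.
exists (nth 1%G (1%G :: s) (find C s)), (nth 1%G s (find C s)).
split; first by move/(pathP 1%G): chs => /(_ _ lt_s).
- case Ei: (find C s) => [|i] //=.
  by rewrite before_find // Ei.
- exact: nth_find.
exact: stepP.
Qed.

Lemma pindex_norm_mul (p : nat) (rT : finGroupType) (G P : {group rT}) (X : {set rT}) :
  p.-Sylow(G) P -> p.-nat #|G : 'N_G(X)| -> 'N_G(X) * P = G.
Proof.
move=> sylP piX; apply: coprime_index_mulG; rewrite ?subsetIl ?(pHall_sub sylP) //.
by case/and3P: sylP => _ _; apply: pnat_coprime.
Qed.

(** As [G = 'N_G(X) P], each Sylow p-subgroup is conjugate to [P] by an element
    normalising [X], so that it contains [X]. *)
Lemma pcore_pindex_norm (p : nat) (rT : finGroupType) (G P X : {group rT}) :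
  p.-Sylow(G) P -> X \subset P -> p.-nat #|G : 'N_G(X)| -> X \subset 'O_p(G).
Proof.
move=> sylP sXP piX; have defG := pindex_norm_mul sylP piX.
apply/bigcapsP=> M; rewrite max_pgroup_Sylow => sylM.
have [x Gx ->] := Sylow_trans sylP sylM.
have: x^-1 \in G by rewrite groupV.
rewrite -defG -sub_conjgV => /mulsgP[n y /setIP[_ nXn] Py ->].
by rewrite conjsgM (normP nXn) sub_conjg conjGid ?groupV.
Qed.

Section PiStep.

Variables (gT : finGroupType) (p : nat) (G P : {group gT}).
Hypothesis sylP : p.-Sylow(G) P.

Let pP := pHall_pgroup sylP.
Let sPG := pHall_sub sylP.

(** As [X] is a p-group, its normaliser has p-power index and [X] lies in the
    p-core, which therefore contains the minimal normal subgroup [K / N]. If [P / N]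
    also normalises [X], then so does ['N(X) (P / N)], the whole of [G / N]. *)
Lemma PiP_pgroup_step (H N K : {group gT}) (X := (H / N) :&: (K / N)) :
    H \subset P -> chief_factor G N K -> X != 1 ->
    \pi(X).-nat #|G / N : 'N_(G / N)(X)| ->
  p.-group (K / N) /\ (P / N \subset 'N(X) -> K / N \subset H / N).
Proof.
move=> sHP chNK ntX piX.
have minK := chief_factor_minnormal chNK.
case/andP: chNK => /maxgroupp/andP[ltNK nNG] /andP[sKG nKG].
have sylPN := quotient_pHall (subset_trans sPG nNG) sylP.
have sXP: X \subset P / N by rewrite subIset // quotientS.
have pX: p.-group X := pgroupS sXP (quotient_pgroup _ pP).
have{} piX: p.-nat #|G / N : 'N_(G / N)(X)|.
  apply: sub_in_pnat piX => q _ /pnatPpi.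
  by apply; move: pX; rewrite /pgroup.
have [/andP[ntK nKG'] minK'] := mingroupP minK.
have minX: forall Y : {group coset_of N}, Y \subset K / N -> Y :!=: 1 ->
    G / N \subset 'N(Y) -> K / N \subset Y.
  by move=> Y sYK ntY nYG; rewrite (minK' Y) ?ntY.
split.
  have sXO := pcore_pindex_norm sylPN sXP piX.
  apply: (pgroupS _ (pcore_pgroup p (G / N))).
  apply: subset_trans (minX ((K / N) :&: 'O_p(G / N))%G _ _ _) (subsetIr _ _).
  - exact: subsetIl.
  - by apply: subG1_contra ntX; rewrite subsetI subsetIr.
  by rewrite normsI ?gFnorm.
move=> nXP; apply: subset_trans (minX [group of X] _ _ _) (subsetIl _ _) => //.
  exact: subsetIr.
by rewrite -(pindex_norm_mul sylPN piX) mul_subG ?subsetIr.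
Qed.

Let PiP_step_neq1 (H N K : {group gT}) : chief_factor G N K ->
  ~~ (H :&: K \subset N) -> (H / N) :&: (K / N) != 1.
Proof.
case/andP=> /maxgroupp/andP[_ nNG] /andP[sKG _]; apply: contra => /eqP X1.
have nNK := subset_trans sKG nNG.
rewrite -quotient_sub1 ?(subset_trans (subsetIr _ _)) // -X1.
exact: quotientI.
Qed.

(** The step [K / N] of the series at which [H :&: T] leaves [S] is a p-group. By
    the dichotomy [T] lies in [K] and [N :&: T] lies in [S], so that [T / S] is a
    section of [K / N]. *)
Lemma PiP_pgroup_factor (H S T : {group gT}) :
    partial_Pi_property G H -> H \subset P -> S <| G -> T <| G ->
    (forall L : {group gT}, L <| G -> T \subset L \/ L :&: T \subset S) ->
    ~~ (H :&: T \subset S) ->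
  p.-group (T / S).
Proof.
move=> PiH sHP nsSG nsTG dichT nsHTS.
have [||N [K [chNK /negPn sN nsK piX]]] :=
  @PiP_first_step _ G H (fun L => ~~ (H :&: T :&: L \subset S)) PiH.
- by rewrite negbK subIset // sub1G orbT.
- by rewrite (setIidPl _) // (subset_trans (subsetIr _ _)) ?normal_sub.
have [/maxgroupp/andP[ltNK nNG] nsKG] := andP chNK.
have nsNG: N <| G.
  by rewrite /normal nNG (subset_trans (proper_sub ltNK)) // normal_sub.
have sTK: T \subset K.
  case: (dichT K nsKG) => // sKTS; case/negP: nsK.
  by apply: subset_trans sKTS; rewrite -setIA (setIC T) subsetIr.
have sNTS: N :&: T \subset S.
  case: (dichT N nsNG) => // sTN; case/negP: nsHTS.
  by apply: subset_trans sN; rewrite subsetI subxx subIset // sTN orbT.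
have ntX: (H / N) :&: (K / N) != 1.
  apply: PiP_step_neq1 => //; apply: contra nsK => sHKN.
  apply: subset_trans sN; rewrite subsetI subsetIl /=.
  by apply: subset_trans sHKN; rewrite setSI // subsetIl.
have [pKN _] := PiP_pgroup_step sHP chNK ntX piX.
have nNT: T \subset 'N(N) := subset_trans (normal_sub nsTG) nNG.
have nST := subset_trans (normal_sub nsTG) (normal_norm nsSG).
have: p.-group (T / (N :&: T)).
  by rewrite (isog_pgroup _ (second_isog nNT)) (pgroupS _ pKN) // quotientS.
rewrite /pgroup !card_quotient ?normsI ?normG // => pi_TN.
rewrite -indexgI (pnat_dvd _ pi_TN) // indexgS // subsetI subsetIr //.
Qed.

(** The hypothesis on [L] says that [F / E] is the unique minimal normal subgroup
    of [G / E]. At the step [K / N] at which [H :&: F] leaves [E], one has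
    [N \subset E] and [F \subset K E]; as [P] normalises [H], it normalises the
    section of [H], whence [K \subset H N]. *)
Lemma PiP_cover_unique_factor (H E F : {group gT}) :
    partial_Pi_property G H -> H \subset P -> P \subset 'N(H) ->
    E <| G -> F <| G -> E \subset F ->
    (forall L : {group gT}, L <| G -> L \subset E \/ F \subset L * E) ->
    P :&: E \subset H -> ~~ (H :&: F \subset E) ->
  F \subset H * E.
Proof.
move=> PiH sHP nHP nsEG nsFG sEF dichF sPEH nsHFE.
have [||N [K [chNK /negPn sN nsK piX]]] :=
  @PiP_first_step _ G H (fun L => ~~ (H :&: F :&: L \subset E)) PiH.
- by rewrite negbK subIset // sub1G orbT.
- by rewrite (setIidPl _) // (subset_trans (subsetIr _ _)) ?normal_sub.
have [/maxgroupp/andP[ltNK nNG] nsKG] := andP chNK.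
have nsNG: N <| G.
  by rewrite /normal nNG (subset_trans (proper_sub ltNK)) // normal_sub.
have sFG := normal_sub nsFG; have nEG := normal_norm nsEG.
have nEF := subset_trans sFG nEG.
have sNE: N \subset E.
  (* Otherwise [N] covers [F / E], so that [P :&: N :&: F] and [E] generate
     [P :&: F]; as [P :&: E] lies in [H], the part of [H] in [F] then comes from
     [E] and [H :&: F :&: N], both inside [E]. *)
  case: (dichF N nsNG) => // sFNE; case/negP: nsHFE.
  have nsM: N :&: F <| G by rewrite normalI.
  have sylM := Hall_setI_normal nsM sylP.
  have sylF := Hall_setI_normal nsFG sylP.
  have qM: (N :&: F) / E = F / E.
    apply/eqP; rewrite eqEsubset quotientS ?subsetIr //= quotientSK //.
    have nEN: commute N E.
      by apply/normC/(subset_trans (normal_sub nsNG)).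
    by rewrite group_modl // subsetI subxx -nEN sFNE.
  have sPFM: (P :&: F) / E \subset (P :&: (N :&: F)) / E.
    have sylME: p.-Sylow(F / E) ((P :&: (N :&: F)) / E).
      have nEM: P :&: (N :&: F) \subset 'N(E).
        by apply: subset_trans nEF; rewrite setIA subsetIr.
      by rewrite -qM quotient_pHall.
    have pPF: p.-group ((P :&: F) / E).
      by rewrite quotient_pgroup // (pgroupS (subsetIl _ _) pP).
    rewrite (sub_pHall sylME pPF) ?quotientS ?subsetIr //.
    by rewrite setIS // subsetIr.
  apply/subsetP=> x /setIP[Hx Fx].
  have: x \in E * (P :&: (N :&: F)).
    have sPFE: P :&: F \subset E * (P :&: (N :&: F)).
      by rewrite -quotientSK // subIset // nEF orbT.
    by rewrite (subsetP sPFE) // inE Fx (subsetP sHP).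
  case/mulsgP=> e y Ee /setIP[Py NFy] defx.
  have He: e \in H.
    have [_ Fy] := setIP NFy.
    rewrite (subsetP sPEH) // inE Ee andbT -(groupMr _ Py) -defx.
    exact: (subsetP sHP).
  rewrite defx groupMl // (subsetP sN) // !inE.
  by have /setIP[-> ->] := NFy; rewrite -(groupMl y He) -defx Hx.
have ntX: (H / N) :&: (K / N) != 1.
  apply: PiP_step_neq1 => //; apply: contra nsK => sHKN.
  apply: subset_trans sNE; apply: subset_trans sHKN.
  by rewrite setIAC subsetIl.
have sKG := normal_sub nsKG; have nNK := subset_trans sKG nNG.
have nXP : P / N \subset 'N(H / N :&: K / N).
  apply: normsI (quotient_norms _ nHP) (quotient_norms _ _).
  exact: subset_trans sPG (normal_norm nsKG).
have [_ /(_ nXP)] := PiP_pgroup_step sHP chNK ntX piX.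
rewrite quotientSK // => sKNH.
case: (dichF K nsKG) => [sKE|sFKE].
  by case/negP: nsK; apply: subset_trans sKE; rewrite subsetIr.
have nEH: commute H E.
  by apply/normC/(subset_trans sHP)/(subset_trans sPG).
apply: (subset_trans sFKE); apply: subset_trans (mulSg E sKNH) _.
by rewrite -mulgA nEH mulgA mulSg // mul_subG.
Qed.

End PiStep.

(** * Two-maximal subgroups of a p-group *)

Section TwoMaximal.

Variables (gT : finGroupType) (p : nat).
Implicit Types H K P M X Y : {group gT}.

Lemma two_maximal_index K P : p.-group P -> two_maximal K P ->
  K \subset P /\ #|P : K| = (p ^ 2)%N.
Proof.
move=> pP /existsP[M /andP[maxK maxM]].
have sMP := maxgroupp maxM; have sKM := maxgroupp maxK.
have pM := pgroupS (proper_sub sMP) pP.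
split; first exact: subset_trans (proper_sub sKM) (proper_sub sMP).
rewrite -(Lagrange_index (proper_sub sMP) (proper_sub sKM)).
by rewrite (p_maximal_index pP maxM) (p_maximal_index pM maxK).
Qed.

Lemma two_maximal_exists Y P : p.-group P -> prime p ->
    Y \subset P -> (p ^ 2 <= #|P : Y|)%N ->
  exists2 K : {group gT}, two_maximal K P & Y \subset K.
Proof.
move=> pP p_pr sYP leY; have p_gt1 := prime_gt1 p_pr.
have [defY | [M maxM sYM]] := maximal_exists sYP.
  by move: leY; rewrite defY indexgg leqNgt (ltn_exp2l 0).
have pM : p.-group M by rewrite (pgroupS (proper_sub (maxgroupp maxM))).
have [defY | [K maxK sYK]] := maximal_exists sYM.
  by move: leY; rewrite defY (p_maximal_index pP maxM) leqNgt (ltn_exp2l 1).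
by exists K => //; apply/existsP; exists M; rewrite maxK.
Qed.

Lemma index_two_maximal K P : p.-group P -> prime p ->
  K \subset P -> #|P : K| = (p ^ 2)%N -> two_maximal K P.
Proof.
move=> pP p_pr sKP iK.
have [|H maxH sKH] := two_maximal_exists pP p_pr sKP; first by rewrite iK.
have [sHP iH] := two_maximal_index pP maxH.
suffices ->: K = H by [].
apply/eqP; rewrite -val_eqE eqEcard sKH /= -(leq_pmul2r (indexg_gt0 P K)).
by rewrite {1}iK -iH !Lagrange.
Qed.

(** If the 2-maximal subgroups all coincide with a subgroup [Z], an element of a
    maximal subgroup outside [Z] generates it, and all elements of prime order
    lie in the cyclic group [Z]: so [P] has a single subgroup of order [p]. *)
Lemma unique_two_maximal_Q8 P :
    p.-group P -> prime p -> (p ^ 3 <= #|P|)%N -> ~~ cyclic P ->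
    {in [pred K | two_maximal K P] &, forall H K, H :=: K} ->
  p = 2%N /\ P \isog 'Q_8.
Proof.
move=> pP p_pr oP not_cycP uniqK; have p_gt1 := prime_gt1 p_pr.
have p_gt0 := prime_gt0 p_pr.
have [|Z maxZ _] := two_maximal_exists pP p_pr (sub1G P).
  by rewrite indexg1 (leq_trans _ oP) // leq_exp2l.
have [sZP iZ] := two_maximal_index pP maxZ.
have ntP: P :!=: 1.
  by apply: contraNneq not_cycP => ->; apply: cyclic1.
have cycM M: maximal M P -> cyclic M.
  move=> maxM; have /andP[sMP _] := maxgroupp maxM.
  have /subsetPn[x Mx notZx]: ~~ (M \subset Z).
    apply/negP=> sMZ; have: (#|P : Z| <= #|P : M|)%N by rewrite dvdn_leq ?indexgS.
    by rewrite iZ (p_maximal_index pP maxM) leqNgt (ltn_exp2l 1).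
  have sxM: <[x]> \subset M by rewrite cycle_subG.
  have [<-|[K maxK sxK]] := maximal_exists sxM; first exact: cycle_cyclic.
  case/negP: notZx; rewrite (uniqK Z K) -?cycle_subG // inE.
  by apply/existsP; exists M; rewrite maxK.
have iZ3: (p <= #|Z|)%N.
  by rewrite -(leq_pmul2r (indexg_gt0 P Z)) Lagrange // iZ -expnS.
have cycZ: cyclic Z.
  have /existsP[M /andP[maxK maxM]] := maxZ.
  exact: cyclicS (proper_sub (maxgroupp maxK)) (cycM M maxM).
have ntZ: Z :!=: 1.
  by rewrite -cardG_gt1 (leq_trans p_gt1).
have pZ := pgroupS sZP pP.
have oOhm: #|'Ohm_1(P)| = p.
  suffices ->: 'Ohm_1(P) = 'Ohm_1(Z) by apply: Ohm1_cyclic_pgroup_prime.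
  apply/eqP; rewrite eqEsubset [X in _ && X]OhmS // andbT -(Ohm_id 1 P) OhmS //.
  rewrite /= Ohm1Eprime gen_subG; apply/subsetP=> x /setIdP[Px oxp].
  have{oxp} ox: #[x] = p.
    have /(pnatP _ (order_gt0 x))/(_ _ oxp (dvdnn _)) := mem_p_elt pP Px.
    by rewrite inE => /eqP.
  have [||K maxK] := @two_maximal_exists <[x]>%G P pP p_pr.
  - by rewrite cycle_subG.
  - rewrite -(leq_pmul2l (cardG_gt0 <[x]>)) Lagrange ?cycle_subG //.
    by rewrite -orderE ox -expnS.
  by rewrite cycle_subG (uniqK K Z).
have /orP[/(negP not_cycP)//|/andP[/eqP p2 /eqP/quaternion_classP[n n_gt2 isoP]]]
  : cyclic P || (p == 2) && (extremal_class P == Quaternion).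
  exact/(prime_Ohm1P pP ntP).
split=> //.
have [[x y] genP _] := generators_quaternion n_gt2 isoP.
case/quaternion_structure: (genP) => // _ _ _ _ structP.
have [n_gt3|] := ltnP 3 n; last first.
  by rewrite leq_eqVlt ltnNge n_gt2 orbF => /eqP n3; rewrite n3 in isoP.
have [_ _ uniqX] := structP n_gt3.
have [_ _ _ /setDP[Py notXy]] := genP.
have sYP: <[y]> \subset P by rewrite cycle_subG.
have [defP|[M maxM sYM]] := maximal_exists sYP.
  by rewrite -defP cycle_cyclic in not_cycP.
case/negP: notXy; rewrite -(uniqX M) ?cycM // -?cycle_subG //.
  exact: proper_sub (maxgroupp maxM).
by rewrite (p_maximal_index pP maxM).
Qed.

End TwoMaximal.

Lemma chief_factor_exists (gT : finGroupType) (G E X : {group gT}) :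
    E <| G -> X <| G -> E \proper X ->
  exists2 F : {group gT}, chief_factor G E F & F \subset X.
Proof.
move=> nsEG nsXG ltEX.
have [|F minF sFX] := @mingroup_exists gT (fun F => (E \proper F) && (F <| G)) X.
  by rewrite ltEX.
have [/andP[ltEF nsFG] minF'] := mingroupP minF.
exists F => //; rewrite /chief_factor nsFG andbT.
apply/maxgroupP; split=> [|H /andP[ltHF nHG] sEH].
  by rewrite ltEF normal_norm.
have sHF := proper_sub ltHF; have sFG := normal_sub nsFG.
apply/eqP; apply: contraT => neqHE.
have ltEH: E \proper H by rewrite properEneq eq_sym neqHE.
have: H :=: F by apply: minF'; rewrite // ltEH /normal nHG (subset_trans sHF).
by move=> defH; rewrite defH properxx in ltHF.
Qed.

Lemma chief_factor_normal (gT : finGroupType) (G N K : {group gT}) :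
  chief_factor G N K -> [/\ N <| G, K <| G & N \proper K].
Proof.
case/andP=> /maxgroupp/andP[ltNK nNG] nsKG; split=> //.
by rewrite /normal nNG (subset_trans (proper_sub ltNK) (normal_sub nsKG)).
Qed.

Lemma quotient_pgroupI pi (gT : finGroupType) (M A B : {group gT}) :
    M \subset 'N(A) -> M \subset 'N(B) ->
  pi.-group (M / A) -> pi.-group (M / B) -> pi.-group (M / (A :&: B)).
Proof.
move=> nAM nBM piA piB; rewrite /pgroup card_quotient ?normsI //.
have piMA: pi.-nat #|M : M :&: A| by rewrite indexgI -card_quotient.
have piMB: pi.-nat #|M :&: A : B|.
  rewrite -card_quotient ?subIset ?nBM //.
  by apply: pgroupS piB; rewrite quotientS ?subsetIl.
rewrite -indexgI setIA -(Lagrange_index (subsetIl M A)) ?subsetIl //.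
by rewrite pnatM piMA (indexgI (M :&: A)%G B).
Qed.

(** * The Sylow subgroup is normal in the p-soluble case *)

Section Complemented.

Variables (p : nat) (gT : finGroupType) (G P F J : {group gT}).
Hypotheses (sylP : p.-Sylow(G) P) (not_nPG : ~~ (P <| G)).
Hypotheses (minF : minnormal F G) (nsFG : F <| G) (pF : p.-group F).
Hypothesis uniqF : forall L : {group gT}, L <| G -> L :=: 1 \/ F \subset L.
Hypotheses (nsJG : J <| G) (sFJ : F \subset J) (p'JF : p^'.-group (J / F)).
Hypothesis nPJG : P <*> J <| G.

(** Let [A] be a Schur-Zassenhaus complement of [F] in [J]. By the Frattini argument
    ['N_G(A)] supplements [F]. If it meets [F], it contains [F] by minimality, so
    [A] is normal in [G], hence trivial; then [P] is [P <*> J]. *)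
Lemma unique_minnormal_complement :
  exists N : {group gT}, [/\ N \subset G, F * N = G & F :&: N = 1].
Proof.
have ntF: F :!=: 1 by case/andP: (mingroupp minF).
have [sFG nFG] := andP nsFG; have [sJG nJG] := andP nsJG.
have nFJ := subset_trans sJG nFG.
have [_ _ /is_abelemP[q _ abelF]] := minnormal_solvable minF (subxx F) (pgroup_sol pF).
have cFF := abelem_abelian abelF.
have nsFJ: F <| J by rewrite /normal sFJ.
have hallF: p.-Hall(J) F.
  by rewrite /pHall sFJ pF -card_quotient.
have /splitsP[A complA] := SchurZassenhaus_split (pHall_Hall hallF) nsFJ.
have [tiFA defJ] := complP complA.
have sAJ: A \subset J by rewrite -defJ mulG_subr.
have hallA: p^'.-Hall(J) A by rewrite -(compl_pHall _ hallF).
have sAG := subset_trans sAJ sJG.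
have defG: F * 'N_G(A) = G.
  apply/eqP; rewrite eqEsubset mul_subG ?subsetIl //=.
  apply/subsetP=> g Gg.
  have [||||x Fx defAg] :=
    @SchurZassenhaus_trans_sol _ F A (A :^ g)%G (pgroup_sol pF).
  - exact: subset_trans sAJ nFJ.
  - by rewrite defJ -(normsP nJG g Gg) conjSg.
  - by rewrite (pnat_coprime pF) //; case/and3P: hallA.
  - by rewrite cardJg.
  have: g * x^-1 \in 'N_G(A).
    rewrite inE groupM ?groupV ?(subsetP sFG x) //=.
    by apply/normP; rewrite conjsgM [A :^ g]defAg conjsgK.
  have nFN: 'N_G(A) \subset 'N(F) by rewrite subIset ?nFG.
  rewrite -(normC nFN).
  by move=> Ngx; apply/mulsgP; exists (g * x^-1) x; rewrite ?mulgKV.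
have nsI: 'N_F(A) <| G.
  rewrite /normal subIset ?sFG //= -{1}defG mulG_subG.
  rewrite sub_abelian_norm ?subsetIl //= normsI //.
    exact: subset_trans (subsetIl _ _) nFG.
  exact: subset_trans (subsetIr _ _) (normG _).
case: (uniqF nsI) => [tiFN | ]; last rewrite subsetI subxx /= => nAF.
  by exists 'N_G(A)%G; rewrite subsetIl setIA (setIidPl sFG).
have nsAG: A <| G.
  by rewrite /normal sAG /= -defG mul_subG // subsetIr.
have A1: A :=: 1.
  case: (uniqF nsAG) => // sFA; case/negP: ntF.
  by rewrite -subG1 -tiFA subsetI subxx.
case/negP: not_nPG; rewrite A1 mulg1 in defJ.
have sFP: F \subset P by rewrite (normal_sub_max_pgroup (Hall_max sylP)).
by rewrite -(joing_idPl sFP) defJ.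
Qed.

End Complemented.

Section TwoMaximalMissingFactor.

Variables (p : nat) (gT : finGroupType) (G P F N : {group gT}).
Hypotheses (p_pr : prime p) (sylP : p.-Sylow(G) P) (not_nPG : ~~ (P <| G)).
Hypotheses (minF : minnormal F G) (nsFG : F <| G) (pF : p.-group F).
Hypothesis uniqF : forall L : {group gT}, L <| G -> L :=: 1 \/ F \subset L.
Hypotheses (sNG : N \subset G) (defG : F * N = G) (tiFN : F :&: N = 1).

(** With [P1 = P :&: N], [P = F P1]. Let [U] have index [p] in [F] and be normal in
    [P], and let [Q] have index [p] in [P1]. Then [U P1] and [F Q] are distinct
    maximal subgroups of [P], and their intersection meets [F] in [U]. *)
Lemma two_maximal_missing_factor :
  exists H : {group gT},
    [/\ H <| P, #|P : H| = (p ^ 2)%N, H :&: F != 1 & ~~ (F \subset H)].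
Proof.
have ntF: F :!=: 1 by case/andP: (mingroupp minF).
have pP := pHall_pgroup sylP; have sPG := pHall_sub sylP.
have [sFG nFG] := andP nsFG.
have [_ _ /is_abelemP[q _ abelF]] := minnormal_solvable minF (subxx F) (pgroup_sol pF).
have cFF := abelem_abelian abelF.
have sFP: F \subset P by rewrite (normal_sub_max_pgroup (Hall_max sylP)).
have nFP := subset_trans sPG nFG; have nsFP: F <| P by rewrite /normal sFP.
pose P1 := (P :&: N)%G.
have defP: F * P1 = P by rewrite /= setIC group_modl // defG (setIidPr sPG).
have sP1P: P1 \subset P := subsetIl _ _.
have tiFP1: F :&: P1 = 1 by rewrite /= setICA tiFN setIg1.
have ntP1: P1 :!=: 1.
  by apply: contraNneq not_nPG => P11; rewrite -defP P11 mulg1.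
have pP1 := pgroupS sP1P pP.
have CF1: 'C_N(F) = 1.
  have nsC: 'C_N(F) <| G.
    rewrite /normal subIset ?sNG //= -{1}defG mulG_subG; apply/andP; split.
      by rewrite cents_norm // centsC subIset // subxx orbT.
    rewrite normsI ?normG // norms_cent //; exact: subset_trans nFG.
  case: (uniqF nsC) => // sFC; case/negP: ntF; rewrite -subG1 -tiFN subsetI subxx.
  by apply: subset_trans sFC _; apply: subsetIl.
have [_ _ [m oF]] := pgroup_pdiv pF ntF.
(* If [F] had order [p] it would be central in [P], while ['C_N(F)], being normal
   in [G] and not containing [F], is trivial; this would force [P1 = 1]. *)
have m_gt0: 0 < m.
  rewrite lt0n; apply: contra ntP1 => /eqP m0; rewrite m0 expn1 in oF.
  have sFZ: F \subset 'Z(P).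
    have := meet_center_nil (pgroup_nil pP) nsFP ntF.
    rewrite setIC => /negPf ntZF; have prF: prime #|F| by rewrite oF.
    have [//|tiZF] := prime_subgroupVti 'Z(P) prF.
    by rewrite tiZF eqxx in ntZF.
  rewrite -subG1 -CF1 subsetI subsetIr centsC.
  by apply: subset_trans sFZ _; rewrite subIset // orbC centS.
have [|U [sUF nsUP oU]] := @normal_pgroup p _ m P F pP nsFP.
  by rewrite oF pfactorK.
have [|Q [_ nsQP1 oQ]] := @normal_pgroup p _ (logn p #|P1|).-1 P1 P1 pP1 (normal_refl _).
  exact: leq_pred.
have [_ _ [k oP1]] := pgroup_pdiv pP1 ntP1.
rewrite oP1 pfactorK //= in oQ.
have [sUP nUP] := andP nsUP; have [sQP1 nQP1] := andP nsQP1.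
pose M1 := (U <*> P1)%G; pose M2 := (F <*> Q)%G.
have defM1: M1 :=: U * P1 by rewrite /= norm_joinEr // (subset_trans sP1P).
have sQP := subset_trans sQP1 sP1P.
have defM2: M2 :=: F * Q by rewrite /= norm_joinEr // (subset_trans sQP).
have oP: #|P| = (p ^ m.+1 * p ^ k.+1)%N by rewrite -defP TI_cardMg // oF oP1.
have tiUP1: U :&: P1 = 1 by apply/trivgP; rewrite -tiFP1 setSI.
have tiFQ: F :&: Q = 1 by apply/trivgP; rewrite -tiFP1 setIS.
have p_gt0 := prime_gt0 p_pr; have p_gt1 := prime_gt1 p_pr.
have sM1P: M1 \subset P by rewrite join_subG sUP.
have sM2P: M2 \subset P by rewrite join_subG sFP.
have iM1: #|P : M1| = p.
  rewrite -divgS // oP defM1 TI_cardMg // oU oP1 expnS -mulnA mulnK //.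
  by rewrite muln_gt0 !expn_gt0 p_gt0.
have iM2: #|P : M2| = p.
  rewrite -divgS // oP defM2 TI_cardMg // oQ oF (expnS _ k) mulnCA mulnK //.
  by rewrite muln_gt0 !expn_gt0 p_gt0.
have maxM1: maximal M1 P by rewrite (p_index_maximal sM1P) ?iM1.
have maxM2: maximal M2 P by rewrite (p_index_maximal sM2P) ?iM2.
have [nsM1 nsM2] := (p_maximal_normal pP maxM1, p_maximal_normal pP maxM2).
have sFM2: F \subset M2 by rewrite joing_subl.
have M1F: M1 :&: F = U.
  by rewrite defM1 setIC -group_modl // setIC in tiFP1 *; rewrite tiFP1 mulg1.
have nsFM1: ~~ (F \subset M1).
  apply/negP=> /setIidPr; rewrite M1F => /(congr1 (fun X : {set gT} => #|X|)) /eqP.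
  by rewrite oU oF eqn_exp2l // -[X in X == _]addn0 -addn1 eqn_add2l.
exists (M1 :&: M2)%G; split.
- exact: normalI.
- rewrite -(Lagrange_index sM1P (subsetIl _ _)) iM1 indexgI.
  have defPM: M2 * M1 = P.
    rewrite (mulg_normal_maximal nsM2) //; apply: contra nsFM1 => sM12.
    suffices <-: M2 :=: M1 by [].
    apply/eqP; rewrite eq_sym eqEcard sM12 /= -(leq_pmul2r p_gt0).
    by rewrite -{1}iM2 -iM1 !Lagrange.
  have := LagrangeMl M2 M1; rewrite defPM -(Lagrange sM2P) iM2 => /eqP.
  by rewrite eqn_pmul2l // => /eqP <-.
- rewrite -setIA (setIidPr sFM2) M1F -cardG_gt1 oU -(exp1n m) ltn_exp2r //.
by apply: contra nsFM1 => /subset_trans-> //; apply: subsetIl.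
Qed.

End TwoMaximalMissingFactor.

Section PLengthOne.

Variables (p : nat) (gT : finGroupType) (G P : {group gT}).
Hypothesis sylP : p.-Sylow(G) P.
Implicit Types E F J L : {group gT}.

Let pP := pHall_pgroup sylP.
Let sPG := pHall_sub sylP.

(** The quotient [G / E] has p-length at most one: some normal p'-subgroup [J / E]
    of it is such that the Sylow subgroup becomes normal modulo [J]. *)
Definition p_length1_mod E :=
  [exists J : {group gT},
     [&& J <| G, E \subset J, p^'.-group (J / E) & P <*> J <| G]].

Lemma p_length1_modP E :
  reflect (exists J, [/\ J <| G, E \subset J, p^'.-group (J / E) & P <*> J <| G])
          (p_length1_mod E).
Proof. by apply: (iffP existsP) => -[J /and4P]; exists J. Qed.

Let joing_normalG J : J <| G -> P <*> J = P * J.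
Proof. by move=> nsJG; rewrite norm_joinEl // (subset_trans sPG) ?normal_norm. Qed.

(** [G / (E1 :&: E2)] embeds in the product of [G / E1] and [G / E2]; the p'-subgroup
    for the intersection is [J1 :&: J2]. *)
Lemma p_length1_modI E1 E2 :
    E1 <| G -> E2 <| G -> p_length1_mod E1 -> p_length1_mod E2 ->
  p_length1_mod (E1 :&: E2).
Proof.
move=> nsE1 nsE2 /p_length1_modP[J1 [nsJ1 sE1 p'J1 nsP1]].
case/p_length1_modP=> J2 [nsJ2 sE2 p'J2 nsP2].
have nsJ: J1 :&: J2 <| G := normalI nsJ1 nsJ2.
have nJM X Y : X <| G -> Y <| G -> X \subset 'N(Y).
  by move=> nsX nsY; rewrite (subset_trans (normal_sub nsX)) ?normal_norm.
apply/p_length1_modP; exists (J1 :&: J2)%G; split=> //; first exact: setISS.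
  apply: quotient_pgroupI; rewrite ?nJM //.
    by apply: pgroupS p'J1; rewrite quotientS ?subsetIl.
  by apply: pgroupS p'J2; rewrite quotientS ?subsetIr.
pose M := ((P <*> J1) :&: (P <*> J2))%G.
have nsM: M <| G by apply: normalI.
have sPM: P \subset M by rewrite subsetI !joing_subl.
have pM: p.-group (M / (J1 :&: J2)).
  apply: quotient_pgroupI; rewrite ?nJM //.
    apply: (@pgroupS _ _ (P / J1)); last exact: quotient_pgroup.
    rewrite /= -(quotientYidr (subset_trans sPG (normal_norm nsJ1))).
    by rewrite quotientS ?subsetIl.
  apply: (@pgroupS _ _ (P / J2)); last exact: quotient_pgroup.
  rewrite /= -(quotientYidr (subset_trans sPG (normal_norm nsJ2))).
  by rewrite quotientS ?subsetIr.
suffices <-: M :=: P <*> (J1 :&: J2) by [].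
have nPJ: P \subset 'N(J1 :&: J2) := subset_trans sPG (normal_norm nsJ).
have sylPM := quotient_pHall nPJ (pHall_subl sPM (normal_sub nsM) sylP).
apply/eqP; rewrite eqEsubset subsetI !genS ?setUS ?subsetIl ?subsetIr // andbT.
rewrite joingC -quotientYK // -sub_quotient_pre ?nJM //.
by rewrite (pHall_id sylPM pM) subxx.
Qed.

(** Take [E] maximal among the normal subgroups for which the quotient has p-length
    greater than one; the trivial subgroup is one of them, since otherwise [P]
    would be normal. As these bad subgroups are the complement of a family closed
    under intersection, there is a unique minimal normal subgroup above [E]. *)
Lemma maximal_not_p_length1 :
    p_soluble p G -> 'O_p^'(G) = 1 -> ~~ (P <| G) ->
  exists E F : {group gT},
    [/\ chief_factor G E F, p.-group (F / E), p_length1_mod F,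
        ~~ p_length1_mod E
      & forall L, L <| G -> L \subset E \/ F \subset L * E].
Proof.
move=> solG Op'1 not_nPG.
have bad1: ~~ p_length1_mod 1.
  apply: contra not_nPG => /p_length1_modP[J [nsJG _ p'J nsPJ]].
  have: J \subset 'O_p^'(G).
    rewrite pcore_max //; move: p'J.
    by rewrite (isog_pgroup _ (isog_symr (quotient1_isog J))).
  rewrite Op'1 => /trivgP J1.
  by rewrite J1 joingG1 in nsPJ.
have [|E maxE _] := @maxgroup_exists _ (fun E => (E <| G) && ~~ p_length1_mod E) 1%G.
  by rewrite normal1.
have [/andP[nsEG badE] maxE'] := maxgroupP maxE.
have goodL L : L <| G -> E \proper L -> p_length1_mod L.
  move=> nsL /andP[sEL not_sLE]; apply: contraR not_sLE => badL.
  by rewrite (maxE' L) ?nsL.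
have ltEG: E \proper G.
  rewrite properEneq normal_sub // andbT; apply: contra badE => /eqP defE.
  apply/p_length1_modP; exists G; rewrite normal_refl defE subxx.
  by rewrite trivg_quotient pgroup1 (joing_idPr sPG) normal_refl.
have [F chF _] := chief_factor_exists nsEG (normal_refl G) ltEG.
have [_ nsFG ltEF] := chief_factor_normal chF.
have goodF := goodL F nsFG ltEF.
exists E, F; split=> //.
  case: (solG _ _ chF) => // p'F; case/negP: badE.
  have /p_length1_modP[J [nsJ sFJ p'J nsPJ]] := goodF.
  apply/p_length1_modP; exists J; split=> //.
    exact: subset_trans (proper_sub ltEF) sFJ.
  have nEJ := subset_trans (normal_sub nsJ) (normal_norm nsEG).
  have nFJ := subset_trans (normal_sub nsJ) (normal_norm nsFG).
  rewrite /pgroup card_quotient // -(Lagrange_index sFJ (proper_sub ltEF)).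
  by rewrite -!card_quotient ?(subset_trans sFJ) // pnatM; apply/andP.
move=> L nsL; have [sLE|not_sLE] := boolP (L \subset E); [by left | right].
have nLE: commute L E.
  exact/normC/(subset_trans (normal_sub nsL) (normal_norm nsEG)).
pose M := (L <*> E)%G.
have defM: M :=: L * E by rewrite /= norm_joinEl // (subset_trans (normal_sub nsL)) ?normal_norm.
have nsM: M <| G by apply: normalY.
have ltEM: E \proper M.
  by rewrite properE joing_subr join_subG subxx (negPf not_sLE).
rewrite -defM; apply: contraR badE => not_sFM.
have defE: F :&: M :=: E.
  have /andP[/maxgroupP[_ maxE2] _] := chF; apply: maxE2.
    rewrite properE subsetIl subsetI subxx (negPf not_sFM) /=.
    by rewrite normsI ?normal_norm.
  by rewrite subsetI !proper_sub.
suffices <-: (F :&: M)%G = E by apply: p_length1_modI; rewrite ?goodL.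
exact: val_inj.
Qed.

End PLengthOne.

(** In the quotient by the [E] of [maximal_not_p_length1], the preimage [H] of the
    2-maximal subgroup of [two_maximal_missing_factor] would have to cover [F / E]
    by [PiP_cover_unique_factor]. *)
Lemma p_soluble_normal_Sylow (p : nat) (gT : finGroupType) (G P : {group gT}) :
    prime p -> p.-Sylow(G) P -> p_soluble p G -> 'O_p^'(G) = 1 ->
    (forall K : {group gT}, two_maximal K P -> partial_Pi_property G K) ->
  P <| G.
Proof.
move=> p_pr sylP solG Op'1 PiP; apply: contraT => not_nPG.
have pP := pHall_pgroup sylP; have sPG := pHall_sub sylP.
have [E [F [chF pF goodF badE uniqF]]] :=
  maximal_not_p_length1 sylP solG Op'1 not_nPG.
have [nsEG nsFG ltEF] := chief_factor_normal chF.
have minF := chief_factor_minnormal chF.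
have [sEF sFG] := (proper_sub ltEF, normal_sub nsFG).
have nEG := normal_norm nsEG; have nEP := subset_trans sPG nEG.
have /p_length1_modP[J [nsJG sFJ p'JF nsPJ]] := goodF.
have nEF := subset_trans sFG nEG.
have nEJ := subset_trans (normal_sub nsJG) nEG.
have sylPE := quotient_pHall nEP sylP.
have not_nPE: ~~ (P / E <| G / E).
  apply: contra badE => nsPE; apply/p_length1_modP; exists E; split=> //.
    by rewrite trivg_quotient pgroup1.
  by rewrite joingC -quotientYK // -(quotientGK nsEG) cosetpre_normal.
have uniqFE (L : {group coset_of E}) : L <| G / E -> L :=: 1 \/ F / E \subset L.
  case/(inv_quotientN nsEG)=> M -> sEM nsMG.
  case: (uniqF M nsMG) => [sME | sFM]; [left | right].
    by rewrite quotientS1.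
  rewrite quotientSK //.
  by rewrite (normC (subset_trans (normal_sub nsMG) nEG)) in sFM.
have p'JFE: p^'.-group ((J / E) / (F / E)).
  have nsEJ: E <| J by rewrite /normal nEJ (subset_trans sEF).
  have nsFJ: F <| J.
    by rewrite /normal sFJ (subset_trans (normal_sub nsJG)) ?normal_norm.
  by rewrite (isog_pgroup _ (third_isog sEF nsEJ nsFJ)).
have nsPJE: (P / E) <*> (J / E) <| G / E by rewrite -quotientY // quotient_normal.
have nsFE: F / E <| G / E by apply: quotient_normal.
have nsJE: J / E <| G / E by apply: quotient_normal.
have sFJE: F / E \subset J / E by apply: quotientS.
have [N [sNG defG tiFN]] := unique_minnormal_complement sylPE not_nPE minF
  nsFE pF uniqFE nsJE sFJE p'JFE nsPJE.
have [Hb [nsHP iHP ntHF not_sFH]] := two_maximal_missing_factor p_pr sylPE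
  not_nPE minF nsFE pF uniqFE sNG defG tiFN.
pose H := (P :&: coset E @*^-1 Hb)%G.
have sHP: H \subset P := subsetIl _ _.
have defHb: H / E = Hb by rewrite quotient_setIpre (setIidPr (normal_sub nsHP)).
have sPEH: P :&: E \subset H by rewrite setIS // sub_cosetpre.
have maxH: two_maximal H P.
  by apply: (index_two_maximal pP p_pr sHP); rewrite -iHP -defHb index_quotient_eq.
have nHP: P \subset 'N(H).
  by apply: normsI (normG _) (norm_quotient_pre nEP (normal_norm nsHP)).
case/negP: not_sFH; rewrite -defHb quotientSK //.
rewrite -(normC (subset_trans sHP nEP)).
apply: (PiP_cover_unique_factor sylP (PiP H maxH)) => //.
apply: contra ntHF; rewrite -quotient_sub1; last by rewrite subIset ?(subset_trans sHP).
by rewrite quotientIG // defHb subG1.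
Qed.

(** * Groups that are not p-soluble *)

(** The transfer into an abelian Sylow subgroup [P] is trivial on a perfect
    group, yet it raises central elements of [P] to the power [#|T : P|]. *)
Lemma perfect_abelian_Sylow_center (p : nat) (gT : finGroupType) (T P : {group gT}) :
  T^`(1) = T -> p.-Sylow(T) P -> abelian P -> P :&: 'Z(T) = 1.
Proof.
move=> perfT sylP cPP; have sPT := pHall_sub sylP.
have abP: abelian (idm P @* P) by rewrite morphim_idm.
apply/trivgP/subsetP=> z /setIP[Pz Zz].
have Tz := subsetP sPT z Pz; have [_ cTz] := setIP Zz.
have: transfer T abP z \in transfer_morphism T abP @* T^`(1).
  by rewrite perfT mem_morphim.
have /derG1P := FinRing.zmod_abelian (transfer_morphism T abP @* T).
rewrite morphim_der // => -> /set1P.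
rewrite /transfer (eq_bigr (fun _ => FiniteModule.fmod abP z)) => [|_ /rcosetsP[x Tx ->]].
  rewrite GRing.sumr_const => /(congr1 val) /=.
  have Pz': z \in idm P @* P by rewrite morphim_idm.
  rewrite FiniteModule.fmvalZ FiniteModule.fmodK // => zn1.
  rewrite inE -order_eq1 -dvdn1; have <-: gcdn (#|P|) #|T : P| = 1%N.
    by apply/eqP; case/and3P: sylP => _; apply: pnat_coprime.
  by rewrite dvdn_gcd order_dvdG //= order_dvdn zn1.
have ->: P :* x :* z = P :* x.
  by rewrite -rcosetM -(centP cTz x Tx) rcosetM (rcoset_id Pz).
have Tr: repr (P :* x) \in T.
  by have /rcosetP[y Py ->] := mem_repr_rcoset P x; rewrite groupM // (subsetP sPT).
by rewrite -(centP cTz _ Tr) mulgK.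
Qed.

(** Hall-Higman for an abelian Sylow subgroup: [Q] centralises ['O_p(S)], and a
    chief factor of [G] just above ['O_p(S)] in ['C_S('O_p(S)) 'O_p(S)] would
    split off a normal p'-subgroup of [G]. *)
Lemma normal_abelian_Sylow (p : nat) (gT : finGroupType) (G S Q : {group gT}) :
    S <| G -> 'O_p^'(G) = 1 -> p.-Sylow(S) Q -> abelian Q ->
    (forall N K : {group gT}, chief_factor G N K -> K \subset S ->
       p.-group (K / N) \/ p^'.-group (K / N)) ->
  Q <| G.
Proof.
move=> nsSG Op'1 sylQ cQQ solS; have [sSG nSG] := andP nsSG.
set R := 'O_p(S)%G; have nsRG: R <| G := gFnormal_trans _ nsSG.
have sRS: R \subset S := gFsub _ _; have pR: p.-group R := pcore_pgroup p S.
have sRQ: R \subset Q := pcore_sub_Hall sylQ.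
have sQS := pHall_sub sylQ.
pose C := 'C_S(R)%G.
have nsCG: C <| G.
  rewrite /normal subIset ?sSG //= normsI ?norms_cent //; exact: normal_norm.
have sQC: Q \subset C by rewrite subsetI sQS (sub_abelian_cent2 cQQ).
suffices sCR: C \subset R.
  suffices ->: Q :=: R by [].
  by apply/eqP; rewrite eqEsubset sRQ (subset_trans sQC).
apply: contraT => not_sCR.
have nsCR: C <*> R <| G by apply: normalY.
have ltRC: R \proper C <*> R.
  by rewrite properE joing_subr join_subG subxx andbT.
have [L chL sLCR] := chief_factor_exists nsRG nsCR ltRC.
have [_ nsLG ltRL] := chief_factor_normal chL.
have nRG := normal_norm nsRG; have nRL := subset_trans (normal_sub nsLG) nRG.
have sRL := proper_sub ltRL.
have sLS: L \subset S.
  by apply: (subset_trans sLCR); rewrite join_subG subsetIl.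
have not_sLR: ~~ (L \subset R) by case/andP: ltRL.
case: (solS _ _ chL sLS) => [pL | p'L].
  case/negP: not_sLR; rewrite pcore_max //; last first.
    exact: normalS sLS sSG nsLG.
  by rewrite -(pquotient_pgroup pR nRL).
pose B := (L :&: C)%G; have nsBG: B <| G by apply: normalI.
have defL: L :=: R * B.
  rewrite /= setIC group_modl // -norm_joinEr ?(subset_trans (normal_sub nsCG)) //.
  by apply/esym/setIidPr; rewrite joingC.
pose D := (R :&: B)%G.
have nRB := subset_trans (normal_sub nsBG) nRG.
have nsDB: D <| B by rewrite /normal subsetIr normsI ?normG.
have hallD: p.-Hall(B) D.
  have iD: #|B : D| = #|B : R| by rewrite -(indexgI B R) (setIC B).
  rewrite /pHall subsetIr (pgroupS (subsetIl _ _) pR) iD.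
  rewrite -card_quotient //; apply: (pgroupS _ p'L).
  by rewrite quotientS ?subsetIl.
have /splitsP[A complA] := SchurZassenhaus_split (pHall_Hall hallD) nsDB.
have [tiDA defB] := complP complA.
have p'A: p^'.-group A.
  by rewrite (compl_pHall _ hallD) in complA; apply: pHall_pgroup complA.
have sAB: A \subset B by rewrite -defB mulG_subr.
have nsAB: A <| B.
  rewrite /normal sAB -{1}defB mulG_subG normG andbT cents_norm // centsC.
  rewrite (subset_trans sAB) // (subset_trans (subsetIr _ _)) // subIset //.
  by rewrite orbC centS // subsetIl.
have: A \subset 'O_p^'(B) by apply: pcore_max.
have ->: 'O_p^'(B) = 1.
  apply/trivgP; rewrite -Op'1 pcore_max ?pcore_pgroup //.
  exact: gFnormal_trans.
move/trivgP=> A1; case/negP: not_sLR.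
rewrite defL mul_subG // -defB A1 mulg1 subsetIl //.
Qed.

(** The automorphism group of a cyclic group is abelian. *)
Lemma der1_cent_cyclic (gT : finGroupType) (T N : {group gT}) :
  T \subset 'N(N) -> cyclic N -> T^`(1) \subset 'C(N).
Proof.
move=> nNT cycN; rewrite -ker_conj_aut ker_trivg_morphim gFsub_trans //=.
rewrite morphim_der // (derG1P _) //.
by apply: abelianS (Aut_cyclic_abelian cycN); apply: Aut_conj_aut.
Qed.

Lemma p_solubleP (p : nat) (gT : finGroupType) (G : {group gT}) :
  reflect (p_soluble p G)
    [forall N : {group gT}, [forall K : {group gT},
       chief_factor G N K ==> p.-group (K / N) || p^'.-group (K / N)]].
Proof.
apply: (iffP forallP) => [solG N K chNK | solG N].
  by have /forallP/(_ K) := solG N; rewrite chNK => /orP.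
by apply/forallP=> K; apply/implyP=> /solG/orP.
Qed.

Section NotPSoluble.

Variables (p : nat) (gT : finGroupType) (G P : {group gT}).
Hypotheses (p_pr : prime p) (sylP : p.-Sylow(G) P) (Op'1 : 'O_p^'(G) = 1).
Hypothesis oP : (p ^ 3 <= #|P|)%N.
Hypothesis PiP : forall K : {group gT}, two_maximal K P -> partial_Pi_property G K.

Let pP := pHall_pgroup sylP.
Let sPG := pHall_sub sylP.
Let p_gt1 := prime_gt1 p_pr.
Let p_gt0 := prime_gt0 p_pr.

(** As [#|P|] is at least [p ^ 3], an element of order [p] of [P :&: N] belongs to
    some 2-maximal subgroup of [P], which has a nontrivial section at [N]. *)
Lemma minimal_normal_pgroup (N : {group gT}) :
  minnormal N G -> N <| G -> p.-group N.
Proof.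
move=> minN nsNG; have [/andP[ntN _] minN'] := mingroupP minN.
have sylN := Hall_setI_normal nsNG sylP.
have ntPN: P :&: N != 1.
  apply: contraNneq ntN => PN1; rewrite -subG1 -Op'1 pcore_max //.
  by have := card_Hall sylN; rewrite /= PN1 cards1 => /esym/eqP; rewrite partG_eq1.
have [_ pdvPN _] := pgroup_pdiv (pgroupS (subsetIl _ _) pP) ntPN.
have [x /setIP[Px Nx] ox] := Cauchy p_pr pdvPN.
have sxP: <[x]> \subset P by rewrite cycle_subG.
have [|K maxK] := two_maximal_exists pP p_pr sxP.
  by rewrite -(leq_pmul2l (cardG_gt0 <[x]>)) Lagrange // -orderE ox -expnS.
rewrite cycle_subG => Kx; have [sKP _] := two_maximal_index pP maxK.
have nK1: ~~ (K :&: N \subset 1%G).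
  apply/subsetPn; exists x; first by rewrite inE Kx.
  by rewrite inE -order_gt1 ox.
rewrite (isog_pgroup _ (quotient1_isog N)).
apply: (PiP_pgroup_factor sylP (PiP maxK) sKP (normal1 G) nsNG _ nK1) => L nsLG.
have [LN1|ntLN] := eqVneq (L :&: N) 1; [by right; rewrite LN1 | left].
rewrite -(minN' (L :&: N)%G) ?subsetIl ?subsetIr // ntLN.
by rewrite normsI ?normal_norm.
Qed.

(** A smallest normal subgroup [T] at the top of a bad chief factor will do: a normal
    subgroup [L] of [G] inside [T] but not inside [S] is the top of the factor
    [L / (L :&: S)], isomorphic to [T / S]. *)
Lemma bad_chief_factor_minimal :
    ~ p_soluble p G ->
  exists S T : {group gT},
    [/\ chief_factor G S T, ~~ p.-group (T / S), ~~ p^'.-group (T / S),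
        forall L : {group gT}, L <| G -> L \subset T -> L :=: T \/ L \subset S
      & forall N K : {group gT}, chief_factor G N K -> K \subset S ->
          p.-group (K / N) \/ p^'.-group (K / N)].
Proof.
move=> not_solG.
pose bad (T S : {group gT}) :=
  [&& chief_factor G S T, ~~ p.-group (T / S) & ~~ p^'.-group (T / S)].
have badP N K : ~~ bad K N -> chief_factor G N K ->
    p.-group (K / N) \/ p^'.-group (K / N).
  by rewrite /bad => + chNK; rewrite chNK /= -negb_or negbK => /orP.
have [T0 badT0] : exists T, [exists S, bad T S].
  move/p_solubleP: not_solG; rewrite negb_forall => /existsP[N].
  rewrite negb_forall => /existsP[K]; rewrite negb_imply negb_or => badK.
  by exists K; apply/existsP; exists N.
have [T minT _] := @mingroup_exists _ (fun T => [exists S, bad T S]) T0 badT0.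
have [/existsP[S badTS] minT'] := mingroupP minT.
have [chT not_pT not_p'T] := and3P badTS; exists S, T; split=> //.
- have [nsSG nsTG ltST] := chief_factor_normal chT; have sST := proper_sub ltST.
  move=> L nsLG sLT; have [sLS|not_sLS] := boolP (L \subset S); [by right | left].
  apply: minT' (sLT); apply/existsP; exists (L :&: S)%G.
  have nSL := subset_trans (normal_sub nsLG) (normal_norm nsSG).
  have maxS (H : {group gT}) : H <| G -> S \subset H -> H \proper T -> H :=: S.
    move=> nsHG sSH ltHT; have [/maxgroupP[_ maxS] _] := andP chT.
    by apply: maxS; rewrite ?ltHT ?normal_norm.
  have defT: L <*> S = T.
    apply: contraNeq not_sLS => neqT; rewrite -(maxS (L <*> S)%G) ?joing_subl //.
    - exact: normalY.
    - exact: joing_subr.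
    by rewrite properEneq neqT join_subG sLT.
  have isoL: L / (L :&: S) \isog T / S.
    by rewrite -defT joingC quotientYidl // setIC second_isog.
  rewrite /bad !(isog_pgroup _ isoL) not_pT not_p'T !andbT /chief_factor nsLG andbT.
  apply/maxgroupP; split=> [|H /andP[ltHL nHG] sLSH].
    rewrite properE subsetIl subsetI subxx not_sLS.
    by rewrite normsI ?normal_norm.
  have sHL := proper_sub ltHL; have nsHG: H <| G.
    by rewrite /normal nHG (subset_trans sHL) ?normal_sub.
  have [sHS|not_sHS] := boolP (H \subset S).
    by apply/eqP; rewrite eqEsubset sLSH subsetI sHL sHS.
  have defT': H <*> S = T.
    apply: contraNeq not_sHS => neqT; rewrite -(maxS (H <*> S)%G) ?joing_subl //.
    - exact: normalY.
    - exact: joing_subr.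
    by rewrite properEneq neqT join_subG (subset_trans sHL).
  case/andP: ltHL => _ /negP[].
  rewrite -(setIidPl sLT) -defT' norm_joinEl ?(subset_trans sHL) //.
  by rewrite setIC -group_modl // mul_subG // setIC.
- move=> N K chK sKS; apply: badP (chK); apply/negP=> badK.
  have [_ _ /andP[sST /negP[]]] := chief_factor_normal chT.
  have <-: K :=: T; last by [].
  by apply: minT'; [apply/existsP; exists N | apply: subset_trans sKS sST].
Qed.

(** Let [T / S] be as in [bad_chief_factor_minimal]; then [T] is perfect, and every
    2-maximal subgroup of [P] meets [T] inside [S]. So each element of [P :&: T]
    outside [S] generates a subgroup of index at most [p] in [P]. By transfer,
    [P :&: T] is not cyclic, which forces [P] into [T], and [Q = P :&: S]
    contains all 2-maximal subgroups.

    If [Q] is cyclic, it has only one subgroup of each order, and [P] has a single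
    2-maximal subgroup. Otherwise two cyclic maximal subgroups of [P] meet in a
    central subgroup [Z] of index [p] in [Q], so that [Q] is abelian and, by
    [normal_abelian_Sylow], normal in [G]. Its subgroup [O] of elements of order
    dividing [p] has order at most [p ^ 2]. It is not minimal normal, since the
    2-maximal subgroup [Z] meets it in order [p]; so [T] acts on [O] with two cyclic
    factors of order at most [p], and centralises [O] as [T] is perfect. But [P]
    is the product of [O] and a cyclic maximal subgroup, hence abelian, and
    transfer gives [O = 1]. *)
Lemma not_p_soluble_Q8 : ~ p_soluble p G -> p = 2%N /\ P \isog 'Q_8.
Proof.
move=> not_solG.
have [S [T [chT not_pT not_p'T dichT solS]]] := bad_chief_factor_minimal not_solG.
have [nsSG nsTG ltST] := chief_factor_normal chT.
have [sST not_sTS] := andP ltST; have [sTG nTG] := andP nsTG.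
have [sSG nSG] := andP nsSG; have nST := subset_trans sTG nSG.
have perfT: T^`(1) = T.
  have nsT' : T^`(1)%G <| G by apply: gFnormal_trans.
  have [//|sT'S] := dichT _ nsT' (der_sub 1 T).
  have abTS : abelian (T / S) by apply: sub_der1_abelian.
  have [_ _ /is_abelemP[q q_pr /abelem_pgroup qT]] :=
    minnormal_solvable (chief_factor_minnormal chT) (subxx _) (abelian_sol abTS).
  have [qp|neq_qp] := eqVneq q p; first by rewrite -qp qT in not_pT.
  case/negP: not_p'T; apply: sub_in_pnat qT => r _ /eqP->.
  by rewrite !inE.
have sKTS K : two_maximal K P -> K :&: T \subset S.
  move=> maxK; have [sKP _] := two_maximal_index pP maxK.
  apply: contraR not_pT.
  apply: (PiP_pgroup_factor sylP (PiP maxK) sKP nsSG nsTG) => L nsLG.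
  have := dichT _ (normalI nsLG nsTG) (subsetIr L T).
  by case=> [LT|]; [left; rewrite -LT subsetIl | right].
have index_x x : x \in P :&: T -> x \notin S -> (#|P : <[x]>| < p ^ 2)%N.
  case/setIP=> Px Tx; rewrite ltnNge; apply: contra => le_p2.
  have sxP: <[x]> \subset P by rewrite cycle_subG.
  have [K maxK] := two_maximal_exists pP p_pr sxP le_p2.
  rewrite cycle_subG => Kx; apply: (subsetP (sKTS K maxK)).
  by rewrite inE Kx.
have sylPT := Hall_setI_normal nsTG sylP.
have [x PTx not_Sx]: exists2 x, x \in P :&: T & x \notin S.
  apply/subsetPn; apply: contra not_p'T => sPTS.
  have nPTS: P :&: T \subset 'N(S) := subset_trans sPTS (normG S).
  have := quotient_pHall nPTS sylPT; rewrite /= (quotientS1 sPTS) => /card_Hall/esym.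
  by rewrite cards1 => /eqP; rewrite partG_eq1.
have ntT: T :!=: 1 by rewrite -proper1G (sub_proper_trans (sub1G S) ltST).
have [N minN sNT] := minnormal_exists ntT nTG.
have [/andP[ntN nNG] minN'] := mingroupP minN.
have nsNG: N <| G by rewrite /normal (subset_trans sNT).
have pN := minimal_normal_pgroup minN nsNG.
have normal_sub_P (L : {group gT}) : p.-group L -> L <| G -> L \subset P.
  exact: normal_sub_max_pgroup (Hall_max sylP).
have sNPT: N \subset P :&: T by rewrite subsetI normal_sub_P.
(* By transfer, since [T] is perfect and [P :&: T] is its Sylow subgroup. *)
have cent_contra (L : {group gT}) :
    abelian (P :&: T) -> L \subset P :&: T -> T \subset 'C(L) -> L :=: 1.
  move=> cPT sLPT cTL; apply/trivgP.
  rewrite -(perfect_abelian_Sylow_center perfT sylPT cPT) subsetI sLPT.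
  by rewrite subsetI (subset_trans sLPT) ?subsetIr // centsC.
have centT (L : {group gT}) : T \subset 'N(L) -> cyclic L -> T \subset 'C(L).
  by move=> nLT cycL; rewrite -perfT der1_cent_cyclic.
have not_cycPT: ~~ cyclic (P :&: T).
  apply: contra ntN => cycPT; rewrite (cent_contra N) ?cyclic_abelian //.
  by rewrite centT ?(cyclicS sNPT) // (subset_trans sTG).
have sxP y : y \in P :&: T -> <[y]> \subset P :&: T by rewrite cycle_subG.
have geq_index (A B : {group gT}) : A \subset P -> B \proper A -> (p <= #|A : B|)%N.
  move=> sAP /andP[sBA not_sAB].
  have: p.-nat #|A : B| by rewrite (pnat_dvd (dvdn_indexg _ _)) // -/(p.-group A) (pgroupS sAP).
  case/p_natP=> [[|k] iAB]; last by rewrite iAB -{1}(expn1 p) leq_pexp2l.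
  by case/negP: not_sAB; rewrite -indexg_eq1 iAB.
have sPT: P \subset T.
  apply/setIidPl/eqP; rewrite eqEsubset subsetIl /=; apply: contraR not_cycPT => not_sPPT.
  have ltPT: P :&: T \proper P by rewrite properE subsetIl.
  apply: contraTT (index_x x PTx not_Sx) => not_cycPT.
  rewrite -leqNgt -(Lagrange_index (subsetIl P T) (sxP x PTx)).
  apply: (@leq_mul p p); apply: geq_index; rewrite ?subsetIl //.
  rewrite properEneq sxP // andbT.
  by apply: contraNneq not_cycPT => <-; apply: cycle_cyclic.
have defPT: P :&: T = P by apply/setIidPl.
rewrite defPT in PTx index_x sylPT sNPT cent_contra not_cycPT sxP.
have cycM y : y \in P -> y \notin S -> maximal <[y]> P.
  move=> Py not_Sy; have syP := sxP y Py.
  have ltyP: <[y]> \proper P.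
    rewrite properEneq syP andbT.
    by apply: contraNneq not_cycPT => <-; apply: cycle_cyclic.
  have [|[M maxM syM]] := maximal_exists syP; first by move=> defP; rewrite defP properxx in ltyP.
  suffices ->: <[y]> :=: M by [].
  apply/eqP; rewrite eqEsubset syM /=; apply: contraLR (index_x y Py not_Sy) => not_sMy.
  have sMP := proper_sub (maxgroupp maxM).
  rewrite -leqNgt -(Lagrange_index sMP syM).
  apply: (@leq_mul p p); apply: geq_index; rewrite ?(maxgroupp maxM) //.
  by rewrite properE syM.
pose Q := (P :&: S)%G; have sQP: Q \subset P by apply: subsetIl.
have sKQ K : two_maximal K P -> K \subset Q.
  move=> maxK; have [sKP _] := two_maximal_index pP maxK.
  by rewrite subsetI sKP -(setIidPl (subset_trans sKP sPT)) sKTS.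
have not_Qx : x \notin Q by rewrite inE negb_and not_Sx orbT.
have [cycQ|not_cycQ] := boolP (cyclic Q).
  apply: unique_two_maximal_Q8 => // K1 K2; rewrite !inE => maxK1 maxK2.
  have [[sK1 i1] [sK2 i2]] := (two_maximal_index pP maxK1, two_maximal_index pP maxK2).
  apply/eqP; rewrite (eq_subG_cyclic cycQ) ?sKQ //.
  by rewrite -(eqn_pmul2r (indexg_gt0 P K1)) {2}i1 -i2 !Lagrange.
have not_sQx y : y \in P -> ~~ (Q \subset <[y]>).
  by move=> Py; apply: contra not_cycQ => sQy; apply: cyclicS sQy (cycle_cyclic y).
have maxIQ y : y \in P -> y \notin S -> maximal (<[y]> :&: Q) <[y]>.
  move=> Py not_Sy; have maxy := cycM y Py not_Sy.
  have not_Qy : y \notin Q by rewrite inE negb_and not_Sy orbT.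
  have [/esym/eqP | [K maxK _]] := maximal_exists (sub1G <[y]>).
    by rewrite cycle_eq1 => /eqP y1; rewrite y1 group1 in not_Sy.
  suffices <-: K :=: <[y]> :&: Q by [].
  have /maxgroupP[/andP[sKy not_sKy] maxK'] := maxK; apply/eqP.
  rewrite eq_sym; apply/eqP; apply: maxK'.
    by rewrite properE subsetIl subsetI subxx cycle_subG.
  by rewrite subsetI sKy sKQ //; apply/existsP; exists <[y]>%G; rewrite maxK.
pose M := <[x]>%G; pose Z := (M :&: Q)%G.
have maxM : maximal M P by apply: cycM.
have maxZ : maximal Z M by apply: maxIQ.
have maxZP : two_maximal Z P by apply/existsP; exists M; rewrite maxZ.
have [sZP iZ] := two_maximal_index pP maxZP.
have nsMP := p_maximal_normal pP maxM; have [sMP nMP] := andP nsMP.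
have [y Qy not_My] := subsetPn (not_sQx x PTx); have [Py Sy] := setIP Qy.
have not_Sxy: x * y \notin S by rewrite groupMr.
have Pxy: x * y \in P by rewrite groupM.
pose M1 := <[x * y]>%G; have maxM1 : maximal M1 P by apply: cycM.
have defP: M * M1 = P.
  rewrite (mulg_normal_maximal nsMP) ?(proper_sub (maxgroupp maxM1)) //.
  by apply: contra not_My; rewrite cycle_subG groupMl ?cycle_id.
have sM1P: M1 \subset P := proper_sub (maxgroupp maxM1).
have defZ: M :&: M1 = Z.
  have iMM1: #|M : M :&: M1| = p.
    apply/eqP; rewrite indexgI -(eqn_pmul2l (cardG_gt0 M1)) LagrangeMl.
    by rewrite (normC (subset_trans sM1P nMP)) defP -(p_maximal_index pP maxM1) Lagrange.
  have maxI: maximal (M :&: M1) M by rewrite (p_index_maximal (subsetIl _ _)) ?iMM1.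
  apply/eqP; rewrite eqEcard subsetI subsetIl sKQ /=; last first.
    by apply/existsP; exists M; rewrite maxI.
  rewrite -(leq_pmul2r p_gt0) -{1}(p_maximal_index (pgroupS sMP pP) maxZ) -iMM1.
  by rewrite !Lagrange ?subsetIl.
have sZM: Z \subset M by apply: subsetIl.
have cZP: P \subset 'C(Z).
  have sZM1: Z \subset M1 by rewrite -defZ subsetIr.
  rewrite -defP mul_subG //.
    exact: sub_abelian_cent2 (cycle_abelian x) (subxx _) sZM.
  exact: sub_abelian_cent2 (cycle_abelian (x * y)) (subxx _) sZM1.
have ltQP: Q \proper P.
  by rewrite properE sQP; apply: contra not_Qx => /subsetP->.
have sZQ: Z \subset Q by apply: subsetIr.
have iZQ: #|Q : Z| = p.
  have ltZQ: Z \proper Q.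
    by rewrite properE sZQ subsetI subxx andbT (not_sQx x).
  apply/eqP; rewrite eqn_leq geq_index // andbT -(leq_pmul2l p_gt0).
  rewrite (leq_trans (leq_mul (geq_index _ _ (subxx P) ltQP) (leqnn _))) //.
  by rewrite Lagrange_index // iZ.
have cQQ: abelian Q.
  have sZZ: Z \subset 'Z(Q) by rewrite subsetI sZQ centsC (subset_trans sQP).
  apply: cyclic_factor_abelian sZZ _; rewrite (dvdn_prime_cyclic p_pr) //.
  by rewrite card_quotient ?iZQ // (subset_trans sQP) // cents_norm.
have nsQG: Q <| G.
  apply: normal_abelian_Sylow (nsSG) Op'1 _ cQQ solS; exact: Hall_setI_normal nsSG sylP.
pose O := 'Ohm_1(Q)%G.
have nsOG: O <| G := gFnormal_trans _ nsQG.
have pQ := pgroupS sQP pP.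
have abelO: p.-abelem O := Ohm1_abelem pQ cQQ.
have sOQ: O \subset Q := Ohm_sub 1 Q.
have cycZ: cyclic Z := cyclicS sZM (cycle_cyclic x).
have not_sOZ: ~~ (O \subset Z).
  apply: contra not_cycQ => sOZ; rewrite abelian_rank1_cyclic // -rank_Ohm1.
  by apply: leq_trans (rankS sOZ) _; rewrite -abelian_rank1_cyclic ?cyclic_abelian.
have sub_O (L : {group gT}) : minnormal L G -> L <| G -> L \subset O.
  move=> minL nsLG; have pL := minimal_normal_pgroup minL nsLG.
  have sLP := normal_sub_P L pL nsLG.
  have sLS: L \subset S.
    case: (dichT L nsLG (subset_trans sLP sPT)) => // defL; case/negP: not_pT.
    by rewrite -defL quotient_pgroup.
  have [_ _ /is_abelemP[q q_pr abelL]] := minnormal_solvable minL (subxx L) (pgroup_sol pL).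
  by rewrite -(Ohm1_id abelL) OhmS // subsetI sLP.
have ntOZ: O :&: Z != 1.
  have ntZ: Z :!=: 1.
    rewrite -cardG_gt1 (leq_trans p_gt1) // -(leq_pmul2r (indexg_gt0 P Z)).
    by rewrite Lagrange // iZ -expnS.
  apply: contraNneq ntZ; rewrite /= setIC => /TI_Ohm1.
  by rewrite (setIidPl sZQ) => ->.
have cyc_small (rT : finGroupType) (A : {group rT}) :
    p.-group A -> (#|A| <= p)%N -> cyclic A.
  case/p_natP=> k oA; rewrite oA -{2}(expn1 p) leq_exp2l // => le_k1.
  by apply: (dvdn_prime_cyclic p_pr); rewrite oA -{2}(expn1 p) dvdn_exp2l.
have oOZ: #|O :&: Z| = p.
  have abelOZ: p.-abelem (O :&: Z) := abelemS (subsetIl _ _) abelO.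
  rewrite -(Ohm1_id abelOZ); apply: Ohm1_cyclic_pgroup_prime ntOZ.
    exact: cyclicS (subsetIr _ _) cycZ.
  exact: abelem_pgroup abelOZ.
have oO: (#|O| <= p ^ 2)%N.
  rewrite -(Lagrange (subsetIl O Z)) oOZ indexgI leq_pmul2l // -iZQ.
  have nZP := cents_norm cZP; have nZQ := subset_trans sQP nZP.
  by rewrite -!card_quotient ?(subset_trans sOQ) // subset_leq_card ?quotientS.
have sNO := sub_O N minN nsNG.
have ltNO: N \proper O.
  rewrite properE sNO; apply: contra not_sOZ => sON.
  have nsZN1: ~~ (Z :&: N \subset 1%G).
    apply: contra ntOZ => sZN1; rewrite -subG1 /= setIC.
    by apply: subset_trans sZN1; rewrite setIS.
  have dichN (L : {group gT}) : L <| G -> L \subset 1%G \/ N \subset L * 1%G.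
    move=> nsLG; have [->|ntL] := eqVneq (L : {set gT}) 1; [by left | right].
    have [N2 minN2 sN2L] := minnormal_exists ntL (normal_norm nsLG).
    have [/andP[ntN2 nN2G] _] := mingroupP minN2.
    have nsN2G: N2 <| G.
      by rewrite /normal nN2G (subset_trans sN2L) ?normal_sub.
    rewrite mulg1 -(minN' N2) ?ntN2 //.
    exact: subset_trans (sub_O N2 minN2 nsN2G) sON.
  have sPZ1: P :&: 1%G \subset Z by rewrite subIset // sub1G orbT.
  have nZP := cents_norm cZP.
  have := PiP_cover_unique_factor sylP (PiP maxZP) sZP nZP (normal1 G) nsNG
            (sub1G N) dichN sPZ1 nsZN1.
  by rewrite mulg1; apply: subset_trans.
have oN: (#|N| <= p)%N.
  rewrite -(leq_pmul2r p_gt0) (leq_trans _ oO) //.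
  rewrite -(Lagrange sNO) leq_mul // geq_index //.
  exact: subset_trans sOQ sQP.
have oON: (#|O / N| <= p)%N.
  have nNO: O \subset 'N(N) := subset_trans (normal_sub nsOG) nNG.
  have pN1: (p <= #|N|)%N.
    by have [_ pN_dvd _] := pgroup_pdiv pN ntN; rewrite dvdn_leq.
  rewrite card_quotient // -(leq_pmul2l p_gt0) (leq_trans _ oO) //.
  by rewrite -(Lagrange sNO) leq_mul.
have nNT := subset_trans sTG nNG; have nOT := subset_trans sTG (normal_norm nsOG).
have cTN: T \subset 'C(N) by rewrite centT ?cyc_small.
have sTON: [~: O, T] \subset N.
  have nNO: O \subset 'N(N) := subset_trans (normal_sub nsOG) nNG.
  rewrite commGC -quotient_cents2 // -{1}perfT quotient_der //.
  rewrite der1_cent_cyclic ?quotient_norms // cyc_small //.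
  by rewrite quotient_pgroup // (pgroupS _ pQ).
have cTO: T \subset 'C(O).
  have OTT: [~: O, T, T] = 1.
    by apply/commG1P; apply: subset_trans sTON _; rewrite centsC.
  have TOT: [~: T, O, T] = 1 by rewrite [[~: T, O]]commGC.
  by rewrite -{1}perfT; apply/commG1P; apply: three_subgroup.
case/negP: (not_sOZ); rewrite (cent_contra O) ?sub1G //; last exact: subset_trans sOQ sQP.
have defMO: M * O = P.
  rewrite (mulg_normal_maximal nsMP) //; first exact: subset_trans sOQ sQP.
  by apply: contra not_sOZ => sOM; rewrite subsetI sOM.
rewrite -defMO abelianM cycle_abelian (abelem_abelian abelO) /=.
by rewrite centsC (subset_trans sMP) // (subset_trans sPT).
Qed.

End NotPSoluble.

(** * Modules of dimension 2 complementing subspaces of codimension 2 *)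

Section TwoDimensionalComplements.

Import GRing.Theory.
Local Open Scope ring_scope.

Variables (F : fieldType) (gT : finGroupType) (G : {group gT}) (n : nat).
Variable rG : mx_representation F G n.

Lemma capmxS0 (m1 m2 : nat) (A B : 'M[F]_(m1, n)) (C D : 'M[F]_(m2, n)) :
  (A <= B)%MS -> (C <= D)%MS -> (B :&: D = 0)%MS -> (A :&: C = 0)%MS.
Proof.
by move=> sAB sCD BD0; apply/eqP; rewrite -submx0 -BD0 capmxS.
Qed.

Lemma hyperplane_exists (U : 'M[F]_n) :
  U != 0 -> exists2 T : 'M[F]_n, (T <= U)%MS & (\rank T).+1 = \rank U.
Proof.
rewrite -mxrank_eq0 -lt0n => rU.
exists (<<(pid_mx (\rank U).-1 : 'M_(\rank U)) *m row_base U>>)%MS.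
  by rewrite genmxE (submx_trans (submxMl _ _)) ?eq_row_base.
rewrite genmxE mxrankMfree ?row_base_free // rank_pid_mx ?leq_pred ?prednK //.
Qed.

(** A plane [D] inside [U2 + Y] would meet [T2 + Y], which has codimension 1
    there. *)
Lemma complement_proj_neq0 (U1 U2 Y T2 D : 'M[F]_n) :
    (U1 :&: U2 = 0)%MS -> ((U1 + U2) :&: Y = 0)%MS -> (1%:M <= U1 + U2 + Y)%MS ->
    (T2 <= U2)%MS -> (\rank T2).+1 = \rank U2 ->
    \rank D = 2%N -> (D :&: (T2 + Y) = 0)%MS ->
  D *m proj_mx U1 (U2 + Y)%MS != 0.
Proof.
move=> dxU12 dxUY sumUY sT2 rT2 rD tiD.
have dxU2Y : (U2 :&: Y = 0)%MS by apply: capmxS0 (addsmxSr _ _) (submx_refl _) dxUY.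
have dxU1 : (U1 :&: (U2 + Y) = 0)%MS.
  apply/eqP; rewrite -mxrank_eq0 -(eqn_add2l (\rank (U1 + (U2 + Y))%MS)).
  rewrite mxrank_sum_cap addn0 addsmxA !mxrank_disjoint_sum //.
  by rewrite addnA.
apply/eqP=> D1.
have sD: (D <= U2 + Y)%MS.
  have sDU: (D <= U1 + (U2 + Y))%MS by rewrite addsmxA (submx_trans (submx1 _)).
  by rewrite -(add_proj_mx dxU1 sDU) D1 add0r proj_mx_sub.
have: (\rank (D + (T2 + Y))%MS <= \rank (U2 + Y)%MS)%N.
  by rewrite mxrankS // addsmx_sub sD addsmxS.
rewrite !mxrank_disjoint_sum // ?rD -?rT2 //; last exact: capmxS0 sT2 (submx_refl _) dxU2Y.
by rewrite !addSn ltnn.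
Qed.

Variables U1 U2 Y : 'M[F]_n.
Hypotheses (dxU12 : (U1 :&: U2 = 0)%MS) (dxUY : ((U1 + U2) :&: Y = 0)%MS).
Hypothesis sumUY : (1%:M <= U1 + U2 + Y)%MS.

Hypothesis compl2 : forall W : 'M[F]_n, (\rank W).+2 = n ->
  exists D : 'M[F]_n, [/\ mxmodule rG D, (\rank D <= 2)%N & (1%:M <= W + D)%MS].

(** The subspace [T1 + T2 + Y] has codimension 2, so the module complementing it has
    dimension exactly 2 and avoids it. *)
Lemma transversal_module (T1 T2 : 'M[F]_n) :
    (T1 <= U1)%MS -> (\rank T1).+1 = \rank U1 ->
    (T2 <= U2)%MS -> (\rank T2).+1 = \rank U2 ->
  exists D : 'M[F]_n,
    [/\ mxmodule rG D, \rank D = 2%N, (D :&: (T1 + T2 + Y) = 0)%MS,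
        D *m proj_mx U1 (U2 + Y)%MS != 0 & D *m proj_mx U2 (U1 + Y)%MS != 0].
Proof.
move=> sT1 rT1 sT2 rT2; pose W := (T1 + T2 + Y)%MS.
have tiT12 : (T1 :&: T2 = 0)%MS := capmxS0 sT1 sT2 dxU12.
have tiTY : ((T1 + T2) :&: Y = 0)%MS.
  exact: capmxS0 (addsmxS sT1 sT2) (submx_refl _) dxUY.
have rW : (\rank W).+2 = n.
  have := mxrankS sumUY; rewrite mxrank1 !mxrank_disjoint_sum // => le_n.
  have := rank_leq_row (U1 + U2 + Y)%MS; rewrite !mxrank_disjoint_sum // => ge_n.
  apply/eqP; rewrite eqn_leq -rT1 -rT2 !(addSn, addnS) in le_n ge_n *.
  by apply/andP.
have [D [modD rD sumWD]] := compl2 rW.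
have rDW : (\rank (D :&: W)%MS + n <= \rank W + \rank D)%N.
  rewrite -mxrank_sum_cap capmxC addnC leq_add2r.
  by have := mxrankS sumWD; rewrite mxrank1.
have [rD2 tiDW] : \rank D = 2%N /\ (D :&: W = 0)%MS.
  have rDW2 : (\rank (D :&: W)%MS + 2 <= \rank D)%N.
    by rewrite -(leq_add2l (\rank W)) addnCA addn2 rW.
  split; first by apply/eqP; rewrite eqn_leq rD (leq_trans _ rDW2) ?leq_addl.
  by apply/eqP; rewrite -mxrank_eq0 -leqn0 -(leq_add2r 2) (leq_trans rDW2).
have tiD2 : (D :&: (T2 + Y) = 0)%MS.
  by apply: capmxS0 (submx_refl _) _ tiDW; rewrite addsmxS ?addsmxSr.
have tiD1 : (D :&: (T1 + Y) = 0)%MS.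
  by apply: capmxS0 (submx_refl _) _ tiDW; rewrite addsmxS ?addsmxSl.
exists D; split=> //.
  exact: complement_proj_neq0 dxU12 dxUY sumUY sT2 rT2 rD2 tiD2.
apply: complement_proj_neq0 sT1 rT1 rD2 tiD1; rewrite ?(addsmxC U2) //.
by rewrite capmxC.
Qed.

Hypotheses (simU1 : mxsimple rG U1) (simU2 : mxsimple rG U2).
Hypothesis modY : mxmodule rG Y.

Let modU1 := mxsimple_module simU1.
Let modU2 := mxsimple_module simU2.

Let dxU1 : (U1 :&: (U2 + Y) = 0)%MS.
Proof.
have dxU2Y : (U2 :&: Y = 0)%MS by apply: capmxS0 (addsmxSr _ _) (submx_refl _) dxUY.
apply/eqP; rewrite -mxrank_eq0 -(eqn_add2l (\rank (U1 + (U2 + Y))%MS)).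
by rewrite mxrank_sum_cap addn0 addsmxA !mxrank_disjoint_sum // addnA.
Qed.

Let dxU2 : (U2 :&: (U1 + Y) = 0)%MS.
Proof.
have dxU1Y : (U1 :&: Y = 0)%MS by apply: capmxS0 (addsmxSl _ _) (submx_refl _) dxUY.
apply/eqP; rewrite -mxrank_eq0 -(eqn_add2l (\rank (U2 + (U1 + Y))%MS)).
rewrite mxrank_sum_cap addn0 addsmxA (addsmxC U2) !mxrank_disjoint_sum //.
by rewrite addnCA addnA.
Qed.

Let p1 := proj_mx U1 (U2 + Y)%MS.
Let p2 := proj_mx U2 (U1 + Y)%MS.

Let hom_p1 m (W : 'M_(m, n)) : (W <= dom_hom_mx rG p1)%MS.
Proof.
apply: submx_trans (submx1 _) (submx_trans _ (proj_mx_hom dxU1 modU1 _)).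
  by rewrite addsmxA.
exact: addsmx_module.
Qed.

Let hom_p2 m (W : 'M_(m, n)) : (W <= dom_hom_mx rG p2)%MS.
Proof.
apply: submx_trans (submx1 _) (submx_trans _ (proj_mx_hom dxU2 modU2 _)).
  by rewrite addsmxA (addsmxC U2).
exact: addsmx_module.
Qed.

(** The module [D] of [transversal_module] projects onto both summands by Schur's
    lemma, so these have dimension at most 2; and if one of them has dimension 2,
    [D] is isomorphic to it, hence simple and isomorphic to the other one too. *)
Lemma simple_pair_rank_iso :
    (\rank U1 = 1%N /\ \rank U2 = 1%N) \/ (\rank U1 = 2%N /\ mx_iso rG U1 U2).
Proof.
have [T1 sT1 rT1] := hyperplane_exists (let: And3 _ nz _ := simU1 in nz).
have [T2 sT2 rT2] := hyperplane_exists (let: And3 _ nz _ := simU2 in nz).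
have [D [modD rD tiD nzD1 nzD2]] := transversal_module sT1 rT1 sT2 rT2.
have ontoD1 : (D *m p1 :=: U1)%MS := mx_Schur_onto modD simU1 (hom_p1 D) (proj_mx_sub _ _ _) nzD1.
have ontoD2 : (D *m p2 :=: U2)%MS := mx_Schur_onto modD simU2 (hom_p2 D) (proj_mx_sub _ _ _) nzD2.
have simD (V p : 'M_n) : mxsimple rG V -> (D <= dom_hom_mx rG p)%MS ->
    (D *m p :=: V)%MS -> \rank V = 2%N -> mxsimple rG D.
  move=> simV homp ontoD rV; split=> [//||X modX sXD nzX].
    by rewrite -mxrank_eq0 rD.
  have tiker : (D :&: kermx p)%MS = 0.
    by apply/eqP/mxrank_injP; rewrite rD -rV ontoD.
  have nzXp : X *m p != 0.
    apply: contra nzX => /eqP Xp0; rewrite -submx0 -tiker sub_capmx sXD.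
    exact/sub_kermxP.
  have sXpV : (X *m p <= V)%MS by rewrite -ontoD submxMr.
  have XV := mx_Schur_onto modX simV (submx_trans sXD homp) sXpV nzXp.
  rewrite -(geq_leqif (mxrank_leqif_sup sXD)) rD -rV -XV.
  exact: mxrankM_maxl.
have isoD : mxsimple rG D -> mx_iso rG U1 U2 /\ \rank U1 = 2%N.
  move=> sD; have iso1 := mx_Schur_iso sD simU1 (hom_p1 D) (proj_mx_sub _ _ _) nzD1.
  have iso2 := mx_Schur_iso sD simU2 (hom_p2 D) (proj_mx_sub _ _ _) nzD2.
  split; last by rewrite -(mxrank_iso iso1).
  exact: mx_iso_trans (mx_iso_sym iso1) iso2.
have r1 : (\rank U1 <= 2)%N by rewrite -ontoD1 -rD mxrankM_maxl.
have r2 : (\rank U2 <= 2)%N by rewrite -ontoD2 -rD mxrankM_maxl.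
have [rU1|] := eqVneq (\rank U1) 2%N.
  by right; have [] := isoD (simD U1 p1 simU1 (hom_p1 D) ontoD1 rU1).
have [rU2|] := eqVneq (\rank U2) 2%N.
  by right; have [] := isoD (simD U2 p2 simU2 (hom_p2 D) ontoD2 rU2).
have := (let: And3 _ nz _ := simU1 in nz); have := (let: And3 _ nz _ := simU2 in nz).
rewrite -!mxrank_eq0; case: (\rank U1) r1 => [|[|[|]]] //.
by case: (\rank U2) r2 => [|[|[|]]] //; left.
Qed.

(** Take a line [<v>] in [U1] and its image in [U2] for the two hyperplanes.
    The transversal [D] is the graph of an isomorphism which, compared with the
    given one, is an endomorphism of [U1] moving [v] to some [w] off the line
    [<v>]. So [v] and [w] span [U1], and [G] acts on [U1] as polynomials in that
    endomorphism. In the proof [q] is the projection to [U2] followed by the given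
    isomorphism back to [U1], and [d], [e] are the elements of [D] above [v], [w]. *)
Lemma simple_pair_commute (v : 'rV[F]_n) a b :
    \rank U1 = 2%N -> mx_iso rG U1 U2 -> (v <= U1)%MS -> a \in G -> b \in G ->
  v *m rG a *m rG b = v *m rG b *m rG a.
Proof.
move=> rU1 isoU12 sv Ga Gb; have [-> | nz_v] := eqVneq v 0; first by rewrite !mul0mx.
have [f uf homf defU2] := isoU12.
have rU2 : \rank U2 = 2%N by rewrite -(mxrank_iso isoU12).
have svf : (v *m f <= U2)%MS by rewrite -defU2 submxMr.
have nz_vf : v *m f != 0.
  by apply: contraNneq nz_v => vf0; rewrite -(mulmxK uf v) vf0 mul0mx.
have [||||D [modD rD tiD nzD1 nzD2]] := @transversal_module <<v>>%MS <<v *m f>>%MS.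
- by rewrite genmxE.
- by rewrite genmxE rank_rV nz_v.
- by rewrite genmxE.
- by rewrite genmxE rank_rV nz_vf.
have ontoD1 : (D *m p1 :=: U1)%MS := mx_Schur_onto modD simU1 (hom_p1 D) (proj_mx_sub _ _ _) nzD1.
have tiker : (D :&: kermx p1)%MS = 0.
  by apply/eqP/mxrank_injP; rewrite rD ontoD1.
have lift (u : 'rV_n) : (u <= U1)%MS -> exists2 d : 'rV_n, (d <= D)%MS & d *m p1 = u.
  rewrite -ontoD1 => /submxP[x ->]; exists (x *m D); first exact: submxMl.
  by rewrite mulmxA.
have injD (d : 'rV_n) : (d <= D)%MS -> d *m p1 = 0 -> d = 0.
  move=> sd d0; apply/eqP; rewrite -submx0 -tiker sub_capmx sd.
  exact/sub_kermxP.
pose q := p2 *m invmx f.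
have homq (x : 'rV_n) c : c \in G -> x *m rG c *m q = x *m q *m rG c.
  move=> Gc; rewrite /q 2!(mulmxA _ p2) (hom_mxP (hom_p2 x)) //.
  have homf' : (x *m p2 <= dom_hom_mx rG (invmx f))%MS.
    rewrite dom_hom_invmx // (submx_trans (proj_mx_sub _ _ _)) // -defU2.
    exact: submxMr.
  by rewrite (hom_mxP homf').
have qU1 (x : 'rV_n) : (x *m q <= U1)%MS.
  rewrite /q (mulmxA _ p2) -[U1](mulmxK uf) submxMr // defU2.
  exact: proj_mx_sub.
have [d sd defv] := lift v sv; pose w := d *m q.
have [e se defw] := lift w (qU1 d); pose z := e *m q.
(* If [w] were in [<v>], the components of [d] in [U1] and [U2] would lie on the
   lines [<v>] and [<v *m f>], and [D] would meet the subspace it avoids. *)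
have not_vw : ~~ (w <= v)%MS.
  apply/negP=> /sub_rVP[c defwc]; case/negP: nz_v; rewrite -defv.
  suffices ->: d = 0 by rewrite mul0mx.
  apply/eqP; rewrite -submx0 -tiD sub_capmx sd /=.
  have dp2 : d *m p2 = c *: (v *m f).
    by rewrite -(mulmxKV uf (d *m p2)) -(mulmxA d p2) -/q -/w defwc -scalemxAl.
  have sd1 : (d - v <= U2 + Y)%MS.
    rewrite -defv; apply: proj_mx_compl_sub.
    by rewrite addsmxA (submx_trans (submx1 _)).
  have sdY : (d - v - d *m p2 <= Y)%MS.
    have vp2 : v *m p2 = 0 by rewrite (proj_mx_0 dxU2) // (submx_trans sv) ?addsmxSl.
    have [[x y] /= dv] := sub_addsmxP sd1.
    have xp2 : x *m U2 *m p2 = x *m U2 by rewrite (proj_mx_id dxU2) ?submxMl.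
    have yp2 : y *m Y *m p2 = 0.
      by rewrite (proj_mx_0 dxU2) // (submx_trans (submxMl _ _)) ?addsmxSr.
    rewrite -[d *m p2]subr0 -vp2 -mulmxBl dv mulmxDl xp2 yp2 addr0 addrAC subrr add0r.
    exact: submxMl.
  have svW : (v <= <<v>> + <<v *m f>> + Y)%MS.
    by rewrite -addsmxA (submx_trans _ (addsmxSl _ _)) ?genmxE.
  have svfW : (v *m f <= <<v>> + <<v *m f>> + Y)%MS.
    by rewrite (submx_trans _ (addsmxSl _ _)) // (submx_trans _ (addsmxSr _ _)) ?genmxE.
  rewrite -[d](subrK v) -[d - v](subrK (d *m p2)) addmx_sub // addmx_sub //.
    by rewrite (submx_trans sdY) ?addsmxSr.
  by rewrite dp2 scalemx_sub.
have spanU1 : (U1 <= v + w)%MS.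
  have sU1 : (v + w <= U1)%MS by rewrite addsmx_sub sv qU1.
  rewrite -(geq_leqif (mxrank_leqif_sup sU1)) rU1.
  have := ltn_leqif (mxrank_leqif_sup (addsmxSl v w)).
  by rewrite addsmx_sub submx_refl not_vw rank_rV nz_v.
have act c : c \in G -> exists x y, v *m rG c = x *: v + y *: w /\ w *m rG c = x *: w + y *: z.
  move=> Gc; have: (v *m rG c <= v + w)%MS.
    by apply: submx_trans spanU1; rewrite mxmodule_trans.
  case/sub_addsmxP=> [[x y]] /=; rewrite [x]mx11_scalar [y]mx11_scalar !mul_scalar_mx.
  move: (x 0 0) (y 0 0) => {}x {}y defvc; exists x, y; split=> //.
  have dc : d *m rG c = x *: d + y *: e.
    apply/eqP; rewrite -subr_eq0; apply/eqP/injD.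
      by rewrite addmx_sub ?mxmodule_trans // eqmx_opp addmx_sub ?scalemx_sub.
    rewrite mulmxBl mulmxDl -!scalemxAl defv defw (hom_mxP (hom_p1 d)) // defv.
    by rewrite defvc subrr.
  by rewrite /w -homq // dc mulmxDl -!scalemxAl.
have [xa [ya [va wa]]] := act a Ga; have [xb [yb [vb wb]]] := act b Gb.
rewrite va vb !mulmxDl -!scalemxAl va wa vb wb !scalerDr !scalerA.
rewrite (mulrC xb xa) (mulrC xb ya) (mulrC yb xa) (mulrC yb ya) !addrA.
by congr (_ + _); rewrite addrAC.
Qed.

End TwoDimensionalComplements.

Lemma sum_mx_eq (F : fieldType) n (I : finType) (V : I -> 'M[F]_n) (B C : 'M[F]_n) :
    (\sum_i V i :=: (1%:M)%R)%MS -> (forall i, V i *m B = V i *m C)%R -> B = C.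
Proof.
move=> sumV eqVBC; apply/eqP; rewrite -GRing.subr_eq0 -submx0 -[(_ - _)%R]mul1mx.
rewrite submx0 (sameP eqP sub_kermxP) -sumV; apply/sumsmx_subP=> i _.
by apply/sub_kermxP; rewrite mulmxBr eqVBC GRing.subrr.
Qed.

Section TwoDimensionalComplementsStructure.

Import GRing.Theory.
Local Open Scope ring_scope.

Variables (F : fieldType) (gT : finGroupType) (G : {group gT}) (n : nat).
Variable rG : mx_representation F G n.
Hypothesis compl2 : forall W : 'M[F]_n, (\rank W).+2 = n ->
  exists D : 'M[F]_n, [/\ mxmodule rG D, (\rank D <= 2)%N & (1%:M <= W + D)%MS].

Variables (I : finType) (V : I -> 'M[F]_n).
Hypotheses (simV : forall i, mxsimple rG (V i)) (sumV : (\sum_i V i :=: 1%:M)%MS).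
Hypothesis dxV : mxdirect (\sum_i V i).

Let rest i j := (\sum_(k | (k != i) && (k != j)) V k)%MS.

Let mod_rest i j : mxmodule rG (rest i j).
Proof. by apply: sumsmx_module => k _; apply: mxsimple_module. Qed.

Let sum_rest i j : j != i -> (1%:M <= V i + V j + rest i j)%MS.
Proof. by move=> neq_ji; rewrite -sumV (bigD1 i) //= (bigD1 j) //= addsmxA. Qed.

Let direct_rest i j : j != i ->
  (V i :&: V j = 0)%MS /\ ((V i + V j) :&: rest i j = 0)%MS.
Proof.
move=> neq_ji; move: dxV; rewrite mxdirectE /= (bigD1 i) //= (bigD1 j) //=.
rewrite [X in _ == X](bigD1 i) //= [X in _ == (_ + X)%N](bigD1 j) //=.
rewrite addsmxA addnA => eq_r.
have: mxdirect (V i + V j + \sum_(k | (k != i) && (k != j)) V k) by rewrite mxdirectE.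
by rewrite mxdirect_addsE /= => /and3P[/mxdirect_addsP ? _ /eqP].
Qed.

Lemma two_dim_complements_structure :
  (forall i, \rank (V i) = 1%N) \/
  (forall i, \rank (V i) = 2%N) /\ (forall i j, mx_iso rG (V i) (V j)).
Proof.
have [all1|] := boolP [forall i, \rank (V i) == 1%N].
  by left=> i; apply/eqP/(forallP all1).
rewrite negb_forall => /existsP[i ri]; right.
have nzV k : V k != 0 by have [] := simV k.
have iso_i j : j != i -> \rank (V i) = 2%N /\ mx_iso rG (V i) (V j).
  move=> neq_ji; have [dxij dxY] := direct_rest neq_ji.
  have [[ri1 _]|//] := simple_pair_rank_iso dxij dxY (sum_rest neq_ji) compl2
                         (simV i) (simV j) (mod_rest i j).
  by rewrite ri1 in ri.
have ri2 : \rank (V i) = 2%N.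
  have [/existsP[j neq_ji]|] := boolP [exists j, j != i].
    by have [] := iso_i j neq_ji.
  rewrite negb_exists => /forallP only_i.
  have defV : (V i :=: 1%:M)%MS.
    apply: eqmx_trans sumV; rewrite (bigD1 i) //= big1 => [|j neq_ji].
      exact: eqmx_sym (addsmx0 _ _).
    by have := only_i j; rewrite neq_ji.
  have rVn : \rank (V i) = n by rewrite defV mxrank1.
  have n2 : (2 <= n)%N.
    by rewrite -rVn ltn_neqAle eq_sym ri lt0n mxrank_eq0 nzV.
  (* The whole space is simple: a module complementing any subspace of codimension
     2 is nonzero, so it is everything, and has dimension at most 2. *)
  have rW : (\rank (pid_mx (n - 2) : 'M[F]_n)).+2 = n.
    by rewrite rank_pid_mx ?leq_subr // -addn2 subnK.
  have [D [modD rD sumWD]] := compl2 rW.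
  have nzD : D != 0.
    apply: contraTneq sumWD => ->; rewrite addsmx0 sub1mx /row_full.
    by rewrite neq_ltn -[ltnRHS]rW ltnW.
  have sVD : (V i <= D)%MS by have [_ _ ->] := simV i; rewrite // defV submx1.
  apply/eqP; rewrite eqn_leq (leq_trans (mxrankS sVD)) //=.
  by rewrite rVn.
have iso_ij j : mx_iso rG (V i) (V j).
  have [->|neq_ji] := eqVneq j i; first exact: mx_iso_refl.
  by have [] := iso_i j neq_ji.
split=> [j|j k]; first by rewrite -(mxrank_iso (iso_ij j)).
exact: mx_iso_trans (mx_iso_sym (iso_ij j)) (iso_ij k).
Qed.

Lemma two_dim_complements_commute :
    (forall i, \rank (V i) = 2%N) -> (forall i j, mx_iso rG (V i) (V j)) ->
    (1 < #|I|)%N ->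
  {in G &, forall a b, rG a *m rG b = rG b *m rG a}.
Proof.
move=> rV isoV I_gt1 a b Ga Gb; apply: (sum_mx_eq sumV) => i.
have /card_gt1P[j [k [_ _ neq_jk]]] := I_gt1.
have [j' neq_ji] : exists j, j != i.
  have [eq_ji|] := eqVneq j i; last by exists j.
  by exists k; rewrite -eq_ji eq_sym.
have [dxij dxY] := direct_rest neq_ji.
apply/row_matrixP=> r; rewrite !mulmxA !row_mul.
apply: (simple_pair_commute dxij dxY (sum_rest neq_ji) compl2 (simV i) (simV j')
  (mod_rest i j')) => //; exact: row_sub.
Qed.

End TwoDimensionalComplementsStructure.

(** * Chief factors below a normal Sylow subgroup *)

Section NormalSylow.

Variables (p : nat) (gT : finGroupType) (G P : {group gT}).
Hypotheses (p_pr : prime p) (sylP : p.-Sylow(G) P) (nsPG : P <| G).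
Implicit Types B H Q : {group gT}.

Let pP := pHall_pgroup sylP.
Let sPG := pHall_sub sylP.

(** A minimal normal subgroup of [G / N] that meets the normal p-subgroup [P / N]
    lies inside it, and then inside its center. *)
Lemma normal_Sylow_chief_factor (N K : {group gT}) :
    chief_factor G N K -> ~~ (K :&: P \subset N) ->
  [/\ K / N \subset P / N, P / N \subset 'C(K / N) & p.-abelem (K / N)].
Proof.
move=> chNK not_sKPN; have [nsNG nsKG ltNK] := chief_factor_normal chNK.
have [minK' minK] := mingroupP (chief_factor_minnormal chNK).
have [ntK nKG] := andP minK'.
have sKG := normal_sub nsKG; have nNG := normal_norm nsNG.
have nNK := subset_trans sKG nNG.
have nsPN : P / N <| G / N by apply: quotient_normal.
have pPN : p.-group (P / N) by apply: quotient_pgroup.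
have sKPN : K / N \subset P / N.
  have ntI : (K :&: P) / N != 1.
    have nNKP : K :&: P \subset 'N(N) by rewrite subIset ?nNK.
    by rewrite -subG1 quotient_sub1.
  have -> : K / N = (K :&: P) / N.
    rewrite (minK ((K :&: P) / N)%G) ?quotientS ?subsetIl // ntI quotient_norms //.
    by rewrite normsI ?normal_norm.
  by rewrite quotientS ?subsetIr.
have pKN : p.-group (K / N) := pgroupS sKPN pPN.
have cPK : P / N \subset 'C(K / N).
  have nsKPN : K / N <| P / N.
    by rewrite /normal sKPN (subset_trans (normal_sub nsPN)).
  have ntZ := meet_center_nil (pgroup_nil pPN) nsKPN ntK.
  have defK : K / N :&: 'Z(P / N) = K / N.
    apply: minK; last exact: subsetIl.
    by rewrite ntZ normsI // gFnorm_trans ?normal_norm.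
  by rewrite centsC -defK subIset // orbC subIset // subxx orbT.
have abelK : p.-abelem (K / N).
  have [_ _] := minnormal_solvable (chief_factor_minnormal chNK) (subxx _) (pgroup_sol pKN).
  by rewrite (is_abelem_pgroup pKN).
by [].
Qed.

(** All the p-factors of a chief series of [G] lie below [P] and are centralised
    by [P], so that [H] either covers or avoids each of them; the factor at which
    the series leaves [B] is therefore avoided by [H]. *)
Lemma PiP_avoided_factor H B :
    partial_Pi_property G H -> H \subset B -> B \proper P ->
  exists Q0 Q : {group gT},
    [/\ [/\ Q0 <| G, Q <| G & Q0 \subset Q], [/\ Q \subset P, Q0 \subset B
      & ~~ (Q \subset B)], H :&: Q \subset Q0, [~: P, Q] \subset Q0
      & p.-abelem (Q / Q0)].
Proof.
move=> PiH sHB ltBP; have [sBP not_sPB] := andP ltBP.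
have sHP := subset_trans sHB sBP.
have [||N [K [chNK /negPn sNB not_sKB piX]]] :=
  @PiP_first_step _ G H (fun L => ~~ (L :&: P \subset B)) PiH.
- by rewrite negbK subIset // sub1G.
- by rewrite (setIidPr sPG).
have [nsNG nsKG ltNK] := chief_factor_normal chNK.
have sKG := normal_sub nsKG; have nNG := normal_norm nsNG.
have nNK := subset_trans sKG nNG; have nNP := subset_trans sPG nNG.
have sQN : ~~ (K :&: P \subset N).
  by apply: contra not_sKB => sKN; apply: subset_trans sNB; rewrite subsetI sKN subsetIr.
have [sKPN cPK abelK] := normal_Sylow_chief_factor chNK sQN.
have avoidN : H :&: K \subset N.
  have [X1|ntX] := eqVneq (H / N :&: K / N) 1.
    by rewrite -quotient_sub1 ?(subset_trans (subsetIr _ _)) // -X1 quotientI.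
  have nXP : P / N \subset 'N(H / N :&: K / N).
    by rewrite cents_norm // (subset_trans cPK) // centS // subsetIr.
  have [_ /(_ nXP)] := PiP_pgroup_step sylP sHP chNK ntX piX.
  rewrite quotientSK // => sKNH; case/negP: not_sKB.
  apply: subset_trans (setSI P sKNH) _.
  by rewrite setIC -group_modr // mul_subG // setIC.
exists (N :&: P)%G, (K :&: P)%G; split.
- by rewrite !normalI // setSI ?(proper_sub ltNK).
- by rewrite subsetIr.
- by rewrite setIA setSI.
- have sPKN : [~: P, K] \subset N by rewrite -quotient_cents2.
  rewrite subsetI (subset_trans (commgS _ (subsetIl _ _)) sPKN) /=.
  by rewrite commg_subl (subset_trans (subsetIr _ _)) ?normG.
have defQ0 : N :&: (K :&: P) = N :&: P by rewrite setIA (setIidPl (proper_sub ltNK)).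
have nNQ : K :&: P \subset 'N(N) by rewrite subIset ?nNK.
rewrite /= -defQ0 (isog_abelem (second_isog nNQ)).
by apply: abelemS abelK; rewrite quotientS ?subsetIl.
Qed.

Let dvd_p2 a b : (a * b = p ^ 2)%N -> a != 1%N -> a = p \/ (a = p ^ 2)%N /\ b = 1%N.
Proof.
move=> defab nt_a; have /(dvdn_pfactor _ _ p_pr)[[|[|[|k]]] // _ defa] : (a %| p ^ 2)%N.
- by rewrite -defab dvdn_mulr.
- by rewrite defa in nt_a.
- by left.
right; split=> //; apply/eqP; rewrite -(eqn_pmul2l (_ : 0 < p ^ 2)) ?expn_gt0 ?prime_gt0 //.
by rewrite -{1}defa defab muln1.
Qed.

(** The index of [H] bounds the factor avoided by [H] to order [p] or [p ^ 2]. In the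
    first case [H Q] is maximal in [P], and it leaves room for a second factor,
    given by [PiP_avoided_factor] with [B := H Q]. *)
Lemma PiP_two_maximal_factors H :
    two_maximal H P -> partial_Pi_property G H ->
  (exists Q0 Q : {group gT},
     [/\ [/\ Q0 <| G, Q <| G & Q0 \subset Q], Q \subset P,
         [/\ Q0 \subset H, H * Q = P & H :&: Q \subset Q0],
         [~: P, Q] \subset Q0 /\ p.-abelem (Q / Q0) & #|Q : Q0| = (p ^ 2)%N])
  \/ (exists Q0 Q R0 R : {group gT},
     [/\ [/\ Q0 <| G, Q <| G & Q0 \subset Q], [/\ R0 <| G, R <| G & R0 \subset R],
         Q \subset P /\ R \subset P, #|Q : Q0| = p /\ #|R : R0| = p
       & [/\ Q0 \subset H, R0 \subset H * Q, maximal (H <*> Q) P,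
             ~~ (R \subset H * Q) & H * Q * R = P]]).
Proof.
move=> maxH PiH; have [sHP iH] := two_maximal_index pP maxH.
have p_gt1 := prime_gt1 p_pr; have p_gt0 := prime_gt0 p_pr.
have ltHP : H \proper P.
  by rewrite properE sHP -indexg_eq1 iH -(exp1n 2) eqn_exp2r // neq_ltn p_gt1 orbT.
have sHG := subset_trans sHP sPG.
have nHL (L : {group gT}) : L <| G -> H \subset 'N(L).
  by move=> nsLG; rewrite (subset_trans sHG) ?normal_norm.
have iHL (L : {group gT}) : L <| G -> #|H <*> L : H| = #|L : H :&: L|.
  move=> nsLG; apply/eqP; rewrite (setIC H) (indexgI L H).
  rewrite -(eqn_pmul2l (cardG_gt0 H)) LagrangeMl Lagrange ?joing_subl //.
  by rewrite /= norm_joinEl ?nHL.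
have [Q0 [Q [[nsQ0 nsQ sQ0Q] [sQP sQ0H not_sQH] sHQ cPQ abQ]]] :=
  PiP_avoided_factor PiH (subxx H) ltHP.
pose M := (H <*> Q)%G; have defM : M :=: H * Q by rewrite /= norm_joinEl ?nHL.
have sMP : M \subset P by rewrite join_subG sHP.
have sHM : H \subset M := joing_subl H Q.
have defI : H :&: Q = Q0 by apply/eqP; rewrite eqEsubset sHQ subsetI sQ0H.
have iMH : #|M : H| = #|Q : Q0| by rewrite iHL ?defI.
have nt_iQ : #|Q : Q0| != 1%N.
  by rewrite indexg_eq1; apply: contra not_sQH => /subset_trans->.
have iPM : (#|Q : Q0| * #|P : M| = p ^ 2)%N.
  by rewrite mulnC -iMH Lagrange_index.
have [iQ | [iQ iPM1]] := dvd_p2 iPM nt_iQ; last first.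
  left; exists Q0, Q; split=> //; split=> //; rewrite -defM.
  by apply/eqP; rewrite eqEsubset sMP -indexg_eq1 iPM1.
have iPMp : #|P : M| = p.
  by apply/eqP; rewrite -(eqn_pmul2l p_gt0) -{1}iQ iPM.
have maxM : maximal M P by rewrite (p_index_maximal sMP) ?iPMp.
have ltMP := maxgroupp maxM; have nsMP := p_maximal_normal pP maxM.
have [R0 [R [[nsR0 nsR sR0R] [sRP sR0M not_sRM] sHR cPR abR]]] :=
  PiP_avoided_factor PiH sHM ltMP.
have nt_iR : #|R : R0| != 1%N.
  by rewrite indexg_eq1; apply: contra not_sRM => /subset_trans->.
have sHRP : H <*> R \subset P by rewrite join_subG sHP.
have iPR : (#|R : R0| * (#|R0 : H :&: R| * #|P : H <*> R|) = p ^ 2)%N.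
  rewrite mulnA Lagrange_index // -iHL // mulnC Lagrange_index ?joing_subl //.
have [iR | [iR /eqP]] := dvd_p2 iPR nt_iR.
  right; exists Q0, Q, R0, R; split=> //; rewrite -defM; split=> //.
  by rewrite (mulg_normal_maximal nsMP).
rewrite muln_eq1 !indexg_eq1 => /andP[sR0H sPHR].
left; exists R0, R; split=> //; split=> //.
  exact: subset_trans sR0H (subsetIl H R).
by apply/eqP; rewrite -norm_joinEl ?nHL // eqEsubset sHRP.
Qed.

(** [H] is normal in [P = H Q], with quotient isomorphic to the elementary abelian
    group [Q / Q0]. *)
Lemma two_maximal_Phi_sub H (Q0 Q : {group gT}) :
    Q \subset P -> Q0 \subset Q -> Q0 \subset H -> H * Q = P -> H :&: Q \subset Q0 ->
    [~: P, Q] \subset Q0 -> p.-abelem (Q / Q0) ->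
  'Phi(P) \subset H.
Proof.
move=> sQP sQ0Q sQ0H defP sHQ cPQ abQ.
have sHP : H \subset P by rewrite -defP mulG_subl.
have nHQ : Q \subset 'N(H).
  rewrite -commg_subl (subset_trans _ sQ0H) // (subset_trans _ cPQ) //.
  by rewrite commSg.
have nHP : P \subset 'N(H) by rewrite -defP mul_subG ?normG.
apply: (Phi_min pP nHP); rewrite -defP quotientMidl.
have defI : H :&: Q = Q0 by apply/eqP; rewrite eqEsubset sHQ subsetI sQ0H.
by rewrite -(isog_abelem (second_isog nHQ)) defI.
Qed.

End NormalSylow.

(** * The Frattini quotient as a module *)

Section FrattiniModule.

Import GRing.Theory.

Variables (p : nat) (gT : finGroupType) (P A : {group gT}).
Hypotheses (p_pr : prime p) (pP : p.-group P) (ntP : P :!=: 1) (nPA : A \subset 'N(P)).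
Hypothesis p'A : p^'.-group A.

Let abV := Frattini_abelem pP.
Let ntV := Frattini_quo_neq1 ntP.
Let rH := Frattini_repr pP ntP nPA.
Let n := 'dim (P / 'Phi(P)).
Let nPhi : P \subset 'N('Phi(P)) := gFnorm _ P.
Implicit Types Q R : {group gT}.

Definition Frattini_mx (Q : {set gT}) : 'M['F_p]_n :=
  rowg_mx (abelem_rV abV ntV @* (Q / 'Phi(P))).
Local Notation fmx := Frattini_mx.

Lemma Frattini_mxS (Q R : {set gT}) : Q \subset R -> (fmx Q <= fmx R)%MS.
Proof. by move=> sQR; rewrite rowg_mxS ?morphimS ?quotientS. Qed.

Lemma Frattini_mxM Q R : Q \subset P -> R \subset P ->
  (fmx (Q * R)%g <= fmx Q + fmx R)%MS.
Proof.
move=> sQP sRP; rewrite -(rowgK (fmx Q + fmx R)%MS) rowg_mxS // rowgD.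
rewrite quotientMl ?(subset_trans sQP) // morphimMl ?quotientS //.
by rewrite mulgSS ?sub_rowg_mx.
Qed.

Lemma Frattini_mx_module Q : Q \subset P -> A \subset 'N(Q) -> mxmodule rH (fmx Q).
Proof.
move=> sQP nQA; rewrite mxmodule_morphim mxmodule_abelemG ?quotientS //.
exact: quotient_norms.
Qed.

Lemma Frattini_mx_rank Q : Q \subset P -> \rank (fmx Q) = logn p #|Q / 'Phi(P)|.
Proof.
by move=> sQP; rewrite mxrank_rowg // card_injm ?abelem_rV_injm ?quotientS.
Qed.

Lemma Frattini_mx1 : ((1%:M)%R <= fmx P)%MS.
Proof.
by rewrite sub1mx /row_full Frattini_mx_rank // -dim_abelemE.
Qed.

Lemma Frattini_mx_sub Q R : Q \subset P -> 'Phi(P) \subset R ->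
  (fmx Q <= fmx R)%MS -> Q \subset R.
Proof.
move=> sQP sPhiR; have sQV : Q / 'Phi(P) \subset P / 'Phi(P) by apply: quotientS.
rewrite rowg_mxSK abelem_rV_S // quotientSGK //.
exact: subset_trans nPhi.
Qed.

Lemma Frattini_mx_surj (W : 'M['F_p]_n) : exists Q,
  [/\ Q \subset P, 'Phi(P) \subset Q, (fmx Q :=: W)%MS & #|P : Q| = (p ^ (n - \rank W))%N].
Proof.
pose Qb := (rVabelem abV ntV @* rowg W)%G.
have sQb : Qb \subset P / 'Phi(P) := sub_rVabelem abV ntV _.
have [Q defQb sPhiQ sQP] := inv_quotientS (Phi_normal P) sQb.
have fQ : (fmx Q :=: W)%MS.
  by rewrite /Frattini_mx -defQb; rewrite rVabelem_mK; exact: rowgK.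
exists Q; split=> //.
have nQ := subset_trans sQP nPhi.
rewrite -(index_quotient_eq _ sQP nPhi); last by rewrite subIset // sPhiQ orbT.
have oQ : #|Q / 'Phi(P)| = (p ^ \rank W)%N.
  by rewrite -defQb /= card_rVabelem card_rowg card_Fp.
rewrite -divgS ?quotientS //= oQ (card_pgroup (abelem_pgroup abV)) -dim_abelemE //.
by rewrite -expnB ?prime_gt0 ?rank_leq_row.
Qed.

(** Maschke's theorem, for the image of [Q0] in the image of [Q]. *)
Lemma Frattini_mx_complement Q0 Q :
    Q0 \subset Q -> Q \subset P -> A \subset 'N(Q0) -> A \subset 'N(Q) ->
  exists D : 'M['F_p]_n, [/\ mxmodule rH D, (\rank D <= logn p #|Q : Q0|)%N
    & (fmx Q <= fmx Q0 + D)%MS].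
Proof.
move=> sQ0Q sQP nQ0A nQA; have sQ0P := subset_trans sQ0Q sQP.
have redV : mx_completely_reducible rH (fmx Q).
  apply: mx_reducibleS (mx_Maschke_pchar _ _).
  - exact: Frattini_mx_module.
  - exact: submx1.
  by rewrite (eq_p'group _ (pcharf_eq (pchar_Fp p_pr))).
have [D modD defQ dxD] := redV _ (Frattini_mx_module sQ0P nQ0A) (Frattini_mxS sQ0Q).
exists D; split=> //; last by rewrite defQ.
have nQ := subset_trans sQP nPhi.
rewrite -(leq_add2l (\rank (fmx Q0))) -(mxdirectP dxD) /= defQ !Frattini_mx_rank //.
rewrite -(Lagrange (quotientS 'Phi(P) sQ0Q)) lognM ?cardG_gt0 ?indexg_gt0 //.
rewrite leq_add2l dvdn_leq_log ?indexg_gt0 //.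
by rewrite index_quotient // subIset // nQ.
Qed.

End FrattiniModule.

Section NormalSylowModule.

Import GRing.Theory.

Variables (p : nat) (gT : finGroupType) (G P A : {group gT}).
Hypotheses (p_pr : prime p) (sylP : p.-Sylow(G) P) (nsPG : P <| G).
Hypotheses (defG : P ><| A = G) (p'A : p^'.-group A).
Hypotheses (pP : p.-group P) (ntP : P :!=: 1) (nPA : A \subset 'N(P)).
Hypothesis PiP : forall K : {group gT}, two_maximal K P -> partial_Pi_property G K.

Let rH := Frattini_repr pP ntP nPA.
Local Notation n := ('dim (P / 'Phi(P))).
Local Notation fmx := (Frattini_mx pP ntP).

Let sAG : A \subset G.
Proof. by case/sdprod_context: defG. Qed.

Let nA (Q : {group gT}) : Q <| G -> A \subset 'N(Q).
Proof. by move=> nsQ; apply: subset_trans sAG (normal_norm nsQ). Qed.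

Let logn_p : logn p p = 1%N.
Proof. by rewrite logn_prime ?eqxx. Qed.

(** The subspace [W] is the image of a 2-maximal subgroup [H]. The factors that [H]
    avoids in [PiP_two_maximal_factors] are spanned, modulo [H], by modules of total
    dimension at most 2. *)
Lemma Frattini_two_dim_complements (W : 'M['F_p]_n) : (\rank W).+2 = n ->
  exists D : 'M['F_p]_n,
    [/\ mxmodule rH D, (\rank D <= 2)%N & ((1%:M)%R <= W + D)%MS].
Proof.
move=> rW; have [H [sHP sPhiH fH iH]] := Frattini_mx_surj p_pr pP ntP W.
have maxH : two_maximal H P.
  apply: (index_two_maximal pP p_pr sHP); rewrite iH; congr (p ^ _)%N.
  by rewrite -[X in (X - _)%N]rW -addn2 addKn.
have sP1 := Frattini_mx1 p_pr pP ntP.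
have [] := PiP_two_maximal_factors p_pr sylP nsPG maxH (PiP maxH).
  case=> Q0 [Q [[nsQ0 nsQ sQ0Q] sQP [sQ0H defP _] _ iQ]].
  have [D [modD rD sumD]] :=
    Frattini_mx_complement p_pr pP ntP nPA p'A sQ0Q sQP (nA nsQ0) (nA nsQ).
  exists D; split=> //; first by rewrite iQ pfactorK in rD.
  have fP : fmx P = fmx (H * Q)%g by rewrite defP.
  apply: submx_trans sP1 _; rewrite fP.
  apply: submx_trans (Frattini_mxM pP ntP sHP sQP) _.
  rewrite addsmx_sub fH addsmxSl (submx_trans sumD) // addsmxS //.
  by rewrite -fH Frattini_mxS.
case=> Q0 [Q [R0 [R [[nsQ0 nsQ sQ0Q] [nsR0 nsR sR0R] [sQP sRP] [iQ iR] [sQ0H sR0M maxM _ defP]]]]].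
have [D [modD rD sumD]] :=
  Frattini_mx_complement p_pr pP ntP nPA p'A sQ0Q sQP (nA nsQ0) (nA nsQ).
have [E [modE rE sumE]] :=
  Frattini_mx_complement p_pr pP ntP nPA p'A sR0R sRP (nA nsR0) (nA nsR).
rewrite iQ logn_p in rD; rewrite iR logn_p in rE.
exists (D + E)%MS; split; first exact: addsmx_module.
  apply: leq_trans (mxrank_adds_leqif _ _) _; exact: (leq_add rD rE).
have nHQ : H \subset 'N(Q).
  by rewrite (subset_trans sHP) // (subset_trans (normal_sub nsPG)) ?normal_norm.
have defM : H <*> Q = H * Q by rewrite norm_joinEl.
have sMP : H <*> Q \subset P by rewrite join_subG sHP.
have fM : (fmx (H * Q)%g <= W + D)%MS.
  apply: submx_trans (Frattini_mxM pP ntP sHP sQP) _.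
  rewrite addsmx_sub fH addsmxSl (submx_trans sumD) // addsmxS //.
  by rewrite -fH Frattini_mxS.
have fP : fmx P = fmx ((H <*> Q) * R)%g by rewrite defM defP.
apply: submx_trans sP1 _; rewrite fP.
apply: submx_trans (Frattini_mxM pP ntP sMP sRP) _.
rewrite addsmxA addsmx_sub /= defM (submx_trans fM) ?addsmxSl //=.
rewrite (submx_trans sumE) // addsmxS // (submx_trans _ fM) //.
by rewrite Frattini_mxS.
Qed.

(** In the second case of [PiP_two_maximal_factors] the factor [R / R0] of order [p]
    would yield a module of dimension at most 1, hence zero: then [R] would lie in
    [R0 'Phi(P)], and thus in the maximal subgroup [H Q]. *)
Lemma Phi_sub_two_maximal (H : {group gT}) :
    (forall D : 'M['F_p]_n, mxmodule rH D -> (\rank D <= 1)%N -> D = 0%R) ->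
  two_maximal H P -> 'Phi(P) \subset H.
Proof.
move=> noline maxH; have [sHP _] := two_maximal_index pP maxH.
have [] := PiP_two_maximal_factors p_pr sylP nsPG maxH (PiP maxH).
  case=> Q0 [Q [[nsQ0 nsQ sQ0Q] sQP [sQ0H defP sHQ] [cPQ abQ] _]].
  exact: (two_maximal_Phi_sub sylP sQP sQ0Q sQ0H defP sHQ cPQ abQ).
case=> Q0 [Q [R0 [R [[nsQ0 nsQ sQ0Q] [nsR0 nsR sR0R] [sQP sRP] [iQ iR] [sQ0H sR0M maxM not_sRM defP]]]]].
have [D [modD rD sumD]] :=
  Frattini_mx_complement p_pr pP ntP nPA p'A sR0R sRP (nA nsR0) (nA nsR).
rewrite iR logn_p in rD.
rewrite (noline D modD rD) in sumD.
have nHQ : H \subset 'N(Q).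
  by rewrite (subset_trans sHP) // (subset_trans (normal_sub nsPG)) ?normal_norm.
have defM : H <*> Q = H * Q by rewrite norm_joinEl.
case/negP: not_sRM; rewrite -defM; apply: (Frattini_mx_sub (pP := pP) (ntP := ntP)) => //.
  exact: Phi_sub_max.
apply: submx_trans sumD _; rewrite addsmx_sub sub0mx andbT Frattini_mxS //.
by rewrite /= defM.
Qed.

(** By coprime action the kernel centralises [P], so it is a normal p'-subgroup of
    [G]. *)
Lemma Frattini_faithful : 'O_p^'(G) = 1 -> mx_faithful rH.
Proof.
move=> Op'1; pose B := [group of rker rH].
have sBA : B \subset A by apply: normal_sub (rker_normal _).
have cPB : B \subset 'C(P).
  have nPB := subset_trans sBA nPA.
  have nPhiB : B \subset 'N('Phi(P)) := subset_trans sBA (Frattini_norm nPA).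
  have coPB : coprime #|P| #|B| := pnat_coprime pP (pgroupS sBA p'A).
  have cVB : B / 'Phi(P) \subset 'C(P / 'Phi(P)).
    rewrite /= /rH rker_morphim rker_abelem.
    apply: subset_trans (quotientS _ (subsetIr _ _)) _.
    by rewrite cosetpreK subsetIr.
  have defCP : 'C_P(B) <*> 'Phi(P) = P.
    have := coprime_quotient_cent (Phi_sub P) nPhiB coPB (pgroup_sol pP).
    rewrite centsC in cVB; rewrite (setIidPl cVB) /= => defCP.
    have nCPhi : 'C_P(B) \subset 'N('Phi(P)) by rewrite subIset // gFnorm.
    rewrite joingC -quotientYK //= defCP.
    by rewrite quotientGK ?Phi_normal.
  have defC : <<'C_P(B)>> = P by apply: Phi_nongen; rewrite joingC.
  by rewrite centsC; apply/setIidPl; rewrite genGid in defC.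
have nsBG : B <| G.
  rewrite /normal (subset_trans sBA) //; case/sdprodP: defG => _ <- _ _.
  rewrite mul_subG ?(normal_norm (rker_normal rH)) // cents_norm // centsC.
  exact: cPB.
by rewrite /mx_faithful -Op'1 pcore_max // (pgroupS sBA p'A).
Qed.

End NormalSylowModule.

(** * Supersolubility from an abelian complement *)

Lemma Fp_Fermat (p : nat) (x : 'F_p) : prime p -> x != 0%R -> (x ^+ p.-1 = 1)%R.
Proof.
move=> p_pr nzx; apply: (GRing.mulfI nzx); have := expf_card x.
by rewrite card_Fp // -GRing.exprS prednK ?prime_gt0 // GRing.mulr1.
Qed.

Section AbelianExponent.

Import GRing.Theory.
Local Open Scope ring_scope.

Variables (p : nat) (gT : finGroupType) (A : {group gT}).
Hypotheses (p_pr : prime p) (abA : abelian A) (expA : (exponent A %| p.-1)%N).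

Lemma Fp_prim_root : exists z : 'F_p, p.-1.-primitive_root z.
Proof.
pose rs := [seq x <- enum 'F_p | x != 0].
have Fp_unity x : x != 0 -> (p.-1).-unity_root (x : 'F_p).
  by move=> nzx; apply/unity_rootP; apply: Fp_Fermat.
have /hasP[z _ prim_z] : has (p.-1).-primitive_root rs.
  apply: has_prim_root; first by rewrite -ltnS prednK ?prime_gt0 ?prime_gt1.
  - by apply/allP=> x; rewrite mem_filter => /andP[/Fp_unity].
  - by rewrite filter_uniq ?enum_uniq.
  rewrite size_filter -(leq_add2l (count (pred1 (0 : 'F_p)) (enum 'F_p))).
  rewrite count_predC -cardE card_Fp // count_uniq_mem ?enum_uniq // mem_enum.
  by rewrite add1n prednK ?prime_gt0.
by exists z.
Qed.

(** The image of [A] is cyclic of order dividing [p.-1], and ['F_p] contains the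
    roots of unity that split its representations. *)
Lemma abelian_exponent_irr_dim1 n (rG : mx_representation 'F_p A n) :
  mx_irreducible rG -> n = 1%N.
Proof.
move=> irrG; pose K := rker rG; pose rQ := kquo_repr rG.
have irrQ : mx_irreducible rQ by apply/quo_mx_irr.
have abQ : abelian (A / K)%g := quotient_abelian _ abA.
have cycQ : cyclic (A / K)%g.
  exact: mx_faithful_irr_abelian_cyclic (kquo_mx_faithful rG) irrQ abQ.
have oQ : (#|A / K|%g %| p.-1)%N.
  rewrite -(exponent_cyclic cycQ).
  exact: dvdn_trans (exponent_quotient _ _) expA.
have [z prim_z] := Fp_prim_root.
apply: (mx_irr_abelian_linear _ irrQ abQ).
exact: primitive_root_splitting_abelian (dvdn_prim_root prim_z oQ) abQ.
Qed.

End AbelianExponent.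

(** A chief factor of order divisible by [p] is centralised by [P], so that it is
    irreducible under [A] alone. *)
Lemma abelian_exponent_p_supersoluble (p : nat) (gT : finGroupType) (G P A : {group gT}) :
    prime p -> p.-Sylow(G) P -> P ><| A = G -> abelian A -> exponent A %| p.-1 ->
  p_supersoluble p G.
Proof.
move=> p_pr sylP defG abA expA N K chNK p_dvd.
have [nsPG sAG defPA _ _] := sdprod_context defG.
have [nsNG nsKG _] := chief_factor_normal chNK.
have [sKG nKG] := andP nsKG; have nNG := normal_norm nsNG.
have not_sKPN : ~~ (K :&: P \subset N).
  apply: contraL p_dvd => sKPN; rewrite -p'natE //.
  have nNKP : K :&: P \subset 'N(N) by rewrite subIset // (subset_trans sKG).
  have := quotient_pHall nNKP (Sylow_setI_normal nsKG sylP).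
  rewrite /= (quotientS1 sKPN) => /card_Hall; rewrite cards1 => /esym/eqP.
  by rewrite partn_eq1 ?cardG_gt0.
have [sKPN cPK abK] := normal_Sylow_chief_factor sylP nsPG chNK not_sKPN.
have minK := chief_factor_minnormal chNK.
have [/andP[ntK nKGN] simK] := mingroupP minK.
have nKA : A / N \subset 'N(K / N) := subset_trans (quotientS N sAG) nKGN.
have irrK : mx_irreducible (abelem_repr abK ntK nKA).
  apply/abelem_mx_irrP/mingroupP; rewrite ntK nKA; split=> // L /andP[ntL nLA] sLK.
  apply: simK => //; rewrite ntL -defPA quotientMl ?mul_subG //.
    by rewrite cents_norm // (subset_trans cPK) ?centS.
  exact: subset_trans (normal_sub nsPG) nNG.
have dim1 : 'dim (K / N) = 1%N.
  apply: abelian_exponent_irr_dim1 irrK => //; first exact: quotient_abelian.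
  exact: dvdn_trans (exponent_quotient _ _) expA.
apply: prime_cyclic; rewrite (card_pgroup (abelem_pgroup abK)).
by rewrite -(dim_abelemE abK) // dim1 expn1.
Qed.

(** * Faithful sums of simple modules *)

Section SumOfModules.

Import GRing.Theory.
Local Open Scope ring_scope.

Variables (F : fieldType) (gT : finGroupType) (A : {group gT}) (n : nat).
Variable rG : mx_representation F A n.
Variables (I : finType) (V : I -> 'M[F]_n).
Hypothesis sumV : (\sum_i V i :=: 1%:M)%MS.

Lemma faithful_commute_abelian :
    mx_faithful rG -> {in A &, forall a b, rG a *m rG b = rG b *m rG a} ->
  abelian A.
Proof.
move=> ffG cGG; apply/centsP=> a Aa b Ab.
by apply: (mx_faithful_inj ffG); rewrite ?groupM // !repr_mxM // (cGG a b).
Qed.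

Lemma rank1_sum_abelian :
    mx_faithful rG -> (forall i, mxmodule rG (V i) /\ \rank (V i) = 1%N) ->
  abelian A.
Proof.
move=> ffG linV; apply: faithful_commute_abelian => // a b Aa Ab.
apply: (sum_mx_eq sumV) => i; have [modV rV] := linV i.
have [u [c defV cu]] := mxmodule_eigenvector modV rV.
have /submxP[w ->] : (V i <= u)%MS by rewrite defV.
rewrite -!mulmxA; congr (w *m _); rewrite !mulmxA !cu // -!scalemxAl !cu //.
by rewrite !scalerA mulrC.
Qed.

(** A module of dimension 1 is simple, hence isomorphic to one of the summands. *)
Lemma simple_sum_no_line :
    (forall i, mxsimple rG (V i)) -> (forall i, \rank (V i) = 2%N) ->
  forall D : 'M[F]_n, mxmodule rG D -> (\rank D <= 1)%N -> D = 0.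
Proof.
move=> simV rV D modD rD; apply/eqP/idPn=> nzD.
have simD : mxsimple rG D.
  split=> // U modU sUD nzU; rewrite -(geq_leqif (mxrank_leqif_sup sUD)).
  by rewrite (leq_trans rD) // lt0n mxrank_eq0.
have [||i _ /mxrank_iso] :=
  @hom_mxsemisimple_iso _ _ _ _ rG I xpredT D V 1%:M simD (fun i _ _ => simV i).
- by rewrite scalar_mx_hom.
- by rewrite mulmx1 sumV submx1.
by rewrite rV => r2; rewrite -r2 in rD.
Qed.

(** An element acting trivially on one summand acts trivially on all of them, so the
    abelian group [A] is faithful on a simple module. *)
Lemma iso_sum_abelian_cyclic (i0 : I) :
    mx_faithful rG -> abelian A -> (forall i, mxsimple rG (V i)) ->
    (forall i j, mx_iso rG (V i) (V j)) ->
  cyclic A.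
Proof.
move=> ffG abA simV isoV; have [modV _ _] := simV i0.
have irrV : mx_irreducible (submod_repr modV) by apply/submod_mx_irr.
apply: mx_faithful_irr_abelian_cyclic irrV abA.
rewrite /mx_faithful rker_submod; apply: subset_trans ffG.
apply/subsetP=> x cVx; have /setIdP[Ax /eqP fixV] := cVx.
apply/rkerP; split=> //; apply: (sum_mx_eq sumV) => i.
have [f _ /hom_mxP homf defV] := isoV i0 i.
have /submxP[w ->] : (V i <= V i0 *m f)%MS by rewrite defV.
by rewrite mulmx1 -!mulmxA; congr (w *m _); rewrite mulmxA -homf // fixV.
Qed.

End SumOfModules.

(** An element of [A] acts on each line by a nonzero scalar of ['F_p]. *)
Lemma Fp_rank1_sum_exponent (p : nat) (gT : finGroupType) (A : {group gT}) n
    (rG : mx_representation 'F_p A n) (I : finType) (V : I -> 'M['F_p]_n) :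
    prime p -> (\sum_i V i :=: (1%:M)%R)%MS -> mx_faithful rG ->
    (forall i, mxmodule rG (V i) /\ \rank (V i) = 1%N) ->
  exponent A %| p.-1.
Proof.
move=> p_pr sumV ffG linV; apply/exponentP=> a Aa.
apply: (mx_faithful_inj ffG); rewrite ?groupX //.
apply: (sum_mx_eq sumV) => i; have [modV rV] := linV i.
have [u [c defV cu]] := mxmodule_eigenvector modV rV.
have /submxP[w ->] : (V i <= u)%MS by rewrite defV.
have ua k : (u *m rG (a ^+ k)%g = c a ^+ k *: u)%R.
  elim: k => [|k IHk]; first by rewrite repr_mx1 mulmx1 GRing.expr0 GRing.scale1r.
  rewrite expgSr repr_mxM ?groupX // mulmxA IHk -scalemxAl cu //.
  by rewrite GRing.scalerA -GRing.exprSr.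
have nzu : u != 0%R by rewrite -mxrank_eq0 -defV rV.
have nzc : c a != 0%R.
  apply: contraNneq nzu => ca0; have := cu a Aa; rewrite ca0 GRing.scale0r => ua0.
  by rewrite -(repr_mxK rG Aa u) ua0 mul0mx.
by rewrite repr_mx1 mulmx1 -mulmxA ua Fp_Fermat // GRing.scale1r.
Qed.

(** * The Frattini quotient without invariant lines *)

Section NormalSylowStructure.

Variables (p : nat) (gT : finGroupType) (G P A : {group gT}).
Hypotheses (p_pr : prime p) (defG : P ><| A = G) (cardP : (p ^ 2 <= #|P|)%N).
Hypotheses (pP : p.-group P) (ntP : P :!=: 1) (nPA : A \subset 'N(P)).

Let rH := Frattini_repr pP ntP nPA.
Local Notation n := ('dim (P / 'Phi(P))).
Local Notation fmx := (Frattini_mx pP ntP).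

Let nsPG : P <| G.
Proof. by case/sdprod_context: defG. Qed.

Hypothesis noline :
  forall D : 'M['F_p]_n, mxmodule rH D -> (\rank D <= 1)%N -> D = 0%R.

Lemma card_Frattini_quo : #|P : 'Phi(P)| = (p ^ n)%N.
Proof.
have abV := Frattini_abelem pP.
rewrite -card_quotient ?gFnorm // (dim_abelemE abV) ?Frattini_quo_neq1 //.
exact: card_pgroup (abelem_pgroup abV).
Qed.

(** Here ['Phi(P)] is trivial, and a normal subgroup of [G] of order [p] in [P] would
    be an invariant line. *)
Lemma no_line_minnormal : #|P| = (p ^ 2)%N -> n = 2%N -> minnormal P G.
Proof.
move=> oP n2; have Phi1 : 'Phi(P) = 1.
  apply/eqP; rewrite trivg_card1 -(eqn_pmul2r (_ : 0 < p ^ 2)%N).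
    by rewrite mul1n -{1}n2 -card_Frattini_quo Lagrange ?Phi_sub // oP.
  by rewrite expn_gt0 prime_gt0.
apply/mingroupP; rewrite ntP (normal_norm nsPG); split=> // L /andP[ntL nLG] sLP.
have sAG : A \subset G by case/sdprod_context: defG.
have modL := Frattini_mx_module pP ntP nPA sLP (subset_trans sAG nLG).
apply/eqP; rewrite eqEcard sLP /= oP.
have [m oL] := p_natP (pgroupS sLP pP); rewrite oL (leq_exp2l _ _ (prime_gt1 p_pr)).
rewrite leqNgt; apply: contra ntL => m_lt2.
rewrite -subG1 -Phi1; apply: (Frattini_mx_sub (pP := pP) (ntP := ntP)) => //.
rewrite (noline modL) ?sub0mx // Frattini_mx_rank // -ltnS.
apply: leq_trans m_lt2; rewrite ltnS -(pfactorK m p_pr) -oL.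
by rewrite dvdn_leq_log ?cardG_gt0 ?dvdn_quotient.
Qed.

Hypothesis sPhi : forall K : {group gT}, two_maximal K P -> 'Phi(P) \subset K.

(** Every 2-maximal subgroup contains ['Phi(P)] and has the same index. *)
Lemma Phi_only_two_maximal_Q8 : (p ^ 3 <= #|P|)%N -> n = 2%N -> p = 2%N /\ P \isog 'Q_8.
Proof.
move=> oP n2; have defK (K : {group gT}) : two_maximal K P -> K = 'Phi(P)%G.
  move=> maxK; have [sKP iK] := two_maximal_index pP maxK.
  apply/esym/val_inj/eqP; rewrite /= eqEcard sPhi //=.
  rewrite -(leq_pmul2r (_ : 0 < p ^ 2)%N) ?expn_gt0 ?prime_gt0 //.
  by rewrite -{1}iK Lagrange // -{1}n2 -card_Frattini_quo Lagrange ?Phi_sub.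
apply: (unique_two_maximal_Q8 pP p_pr oP) => [|H K /defK-> /defK->] //.
apply: contraTN isT => cycP; have abV := Frattini_abelem pP.
have := quotient_cyclic 'Phi(P) cycP; rewrite (abelem_cyclic abV).
by rewrite -(dim_abelemE abV) ?Frattini_quo_neq1 // n2.
Qed.

(** For the less obvious inclusion, each maximal subgroup of [P] contains a 2-maximal
    one. *)
Lemma Phi_bigcap_two_maximal :
  'Phi(P) = \bigcap_(K : {group gT} | two_maximal K P) (K : {set gT}).
Proof.
apply/eqP; rewrite eqEsubset; apply/andP; split.
  by apply/bigcapsP=> K /sPhi.
have [K0 maxK0 _] : exists2 K : {group gT}, two_maximal K P & 1%G \subset K.
  by apply: (two_maximal_exists pP p_pr); rewrite ?sub1G ?indexg1.
apply/bigcapsP=> M /predU1P[-> | maxM].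
  by have [sK0P _] := two_maximal_index pP maxK0; exact: (bigcap_min K0).
have [M1 | [K maxK _]] := maximal_exists (sub1G M).
  move: cardP; rewrite -indexg1 M1 (p_maximal_index pP maxM) -{2}(expn1 p).
  by rewrite (leq_exp2l _ _ (prime_gt1 p_pr)).
have maxKP : two_maximal K P by apply/existsP; exists M; rewrite maxK.
exact: (bigcap_min K maxKP (proper_sub (maxgroupp maxK))).
Qed.

End NormalSylowStructure.

(** * The alternatives *)

Theorem theoremB (gT : finGroupType) (p : nat) (G P : {group gT})
    (p_pr : prime p) (sylP : p.-Sylow(G) P)
    (Op'G : 'O_p^'(G) = 1) (cardP : (p ^ 2 <= #|P|)%N)
    (PiP : forall K : {group gT}, two_maximal K P -> partial_Pi_property G K) :
  p_supersoluble p G \/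
  [/\ #|P| = (p ^ 2)%N, P :=: 'O_p(G) & minnormal P G] \/
  (#|P| = (p ^ 2)%N /\ ~ p_soluble p G) \/
  (p = 2%N /\ P \isog 'Q_8) \/
  ((p ^ 3 <= #|P|)%N /\
   exists H : {group gT},
     [/\ P ><| H = G, p^'.-Hall(G) H, cyclic H,
         'Phi(P) = \bigcap_(K : {group gT} | two_maximal K P) (K : {set gT})
       & exists (pP : p.-group P) (ntP : P :!=: 1) (nPH : H \subset 'N(P)),
         let rH := Frattini_repr pP ntP nPH in
         exists (s : nat) (V : 'I_s -> 'M['F_p]_('dim (P / 'Phi(P)))),
           [/\ (\sum_i V i :=: (1%:M)%R)%MS,
               mxdirect (\sum_i V i),
               forall i, mxsimple rH (V i) /\ \rank (V i) = 2%N
             & forall i j, mx_iso rH (V i) (V j)]]).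
Proof.
have ltpP : (1 < #|P|)%N.
  by apply: leq_trans cardP; rewrite (ltn_exp2l 0 _ (prime_gt1 p_pr)).
have pP := pHall_pgroup sylP; have ntP : P :!=: 1 by rewrite -cardG_gt1.
have large : #|P| != (p ^ 2)%N -> (p ^ 3 <= #|P|)%N.
  have [m oP] := p_natP pP; have p_gt1 := prime_gt1 p_pr; move: cardP.
  rewrite oP (eqn_exp2l _ _ p_gt1) !(leq_exp2l _ _ p_gt1) => m_ge2 m_neq2.
  by rewrite ltn_neqAle eq_sym m_neq2.
have [solG | not_solG] := p_solubleP p G; last first.
  have [oP | /large oP] := eqVneq #|P| (p ^ 2)%N; first by do 2!right; left.
  by do 3!right; left; apply: not_p_soluble_Q8 oP PiP not_solG.
have nsPG := p_soluble_normal_Sylow p_pr sylP solG Op'G PiP.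
have [sPG nPG] := andP nsPG.
have /splitsP[A /complP[tiPA defPA]] := SchurZassenhaus_split (pHall_Hall sylP) nsPG.
have sAG : A \subset G by rewrite -defPA mulG_subr.
have nPA := subset_trans sAG nPG.
have defG : P ><| A = G by rewrite sdprodE.
have hallA : p^'.-Hall(G) A.
  rewrite /pHall sAG -(divgS sAG) -(sdprod_card defG) mulnK // pnatNK.
  rewrite -/(p.-group P) pP andbT /pgroup (index_sdprod defG).
  by case/and3P: sylP.
have p'A := pHall_pgroup hallA.
pose rH := Frattini_repr pP ntP nPA.
have ffA : mx_faithful rH := Frattini_faithful defG p'A pP ntP nPA Op'G.
have compl2 := Frattini_two_dim_complements p_pr sylP nsPG defG p'A pP ntP nPA PiP.
have [I V sumVi simV sumV dxV] : mxsemisimple rH (1%:M)%R.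
  apply: dec_mx_reducible_semisimple (mxmodule1 _) (mx_Maschke_pchar _ _).
  by rewrite (eq_p'group _ (GRing.pcharf_eq (pchar_Fp p_pr))).
subst sumVi; have modV i : mxmodule rH (V i) by have [] := simV i.
have [rV1 | [rV2 isoV]] := two_dim_complements_structure compl2 simV sumV dxV.
  left; apply: (abelian_exponent_p_supersoluble p_pr sylP defG).
    exact: (rank1_sum_abelian sumV ffA).
  exact: (Fp_rank1_sum_exponent p_pr sumV ffA).
have noline := simple_sum_no_line sumV simV rV2.
have sPhi K := Phi_sub_two_maximal p_pr sylP nsPG defG p'A PiP noline (H := K).
have dimV : 'dim (P / 'Phi(P)) = (2 * #|I|)%N.
  have := mxrank1 'F_p ('dim (P / 'Phi(P))); rewrite -sumV (mxdirectP dxV) /= => <-.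
  by rewrite (eq_bigr (fun=> 2%N)) // sum_nat_const mulnC.
have [I_gt1 | I_le1] := ltnP 1 #|I|.
  have abA : abelian A.
    apply: faithful_commute_abelian ffA _.
    exact: (two_dim_complements_commute compl2 simV sumV dxV rV2 isoV I_gt1).
  have /card_gt1P[i0 _] := I_gt1.
  do 4!right; split.
    apply: leq_trans (dvdn_leq (cardG_gt0 P) (dvdn_indexg P 'Phi(P)%G)).
    rewrite (card_Frattini_quo pP ntP) dimV (leq_exp2l _ _ (prime_gt1 p_pr)).
    by rewrite (leq_trans (isT : (3 <= 2 * 2)%N)) // leq_mul2l.
  exists A; split=> //.
  - exact: iso_sum_abelian_cyclic sumV i0 ffA abA simV isoV.
  - exact: (Phi_bigcap_two_maximal p_pr cardP pP sPhi).
  exists pP, ntP, nPA; rewrite -/rH; exists #|I|, (fun k => V (enum_val k)).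
  have bijI : bijective (enum_val : 'I_#|I| -> I) := enum_val_bij I.
  have reV : (\sum_(k < #|I|) V (enum_val k))%MS = (\sum_i V i)%MS.
    by apply: esym; apply: (reindex _ (onW_bij _ bijI)).
  split=> //; first by rewrite reV.
  have /mxdirectP /= := dxV; rewrite -reV => rankV.
  by apply/mxdirectP; rewrite /= rankV [LHS](reindex _ (onW_bij _ bijI)).
have I1 : #|I| = 1%N.
  by case: #|I| I_le1 dimV => [|[]].
rewrite I1 in dimV.
have [oP | /large oP] := eqVneq #|P| (p ^ 2)%N.
  right; left; split=> //; first by rewrite (normal_Hall_pcore sylP).
  exact: no_line_minnormal noline oP dimV.
by do 3!right; left; apply: Phi_only_two_maximal_Q8 sPhi oP dimV.
Qed.
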